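(* A Borel set $B\subset D^d$ is non-polar, i.e. $\mathbb{P}\{\exists t\in D^N:X_t\in B\}>0$, if and only if there exists a non-trivial finite measure $\mu$ with $\mu(D^d\setminus B)=0$ and $\int\int u(|x-y|)\,\mu(dx)\,\mu(dy)<\infty$.
   Context: $K$ is a local field with non-archimedean absolute value $|\cdot|$ taking values in $\{q^k:k\in\mathbb{Z}\}\cup\{0\}$; $D=\{x:|x|\le1\}$, $\rho\in K$ with $|\rho|=q^{-1}$, $\lambda$ Haar measure on $K$ with $\lambda(D)=1$. Fix positive integers $N,d$; $K^N,K^d$ have norm $|(x_1,\dots)|=\max_i|x_i|$. For $n\ge0$, $\mathcal{D}(N;n)$ is the set of cosets of $\rho^nD^N$ in $D^N$, $\Gamma(N)=\bigcup_n\mathcal{D}(N;n)$. Let $(Z_{C,i})_{C\in\Gamma(N),1\le i\le d}$ be independent, with $Z_{C,i}$ uniformly distributed on $\rho^nD$ for $C\in\mathcal{D}(N;n)$; $Z_C=(Z_{C,i})_{i\le d}$. On the a.s. event where $|Z_{C,i}|\le q^{-n}$ for all $n,C\in\mathcal{D}(N;n),i$, put $X_t=\sum_{n\ge0}\sum_{C\in\mathcal{D}(N;n)}Z_C\mathbf{1}_C(t)$, $t\in D^N$, and $X\equiv0$ otherwise (the probability space is completed). The function $u:\{q^{-k}\}_{k\ge0}\cup\{0\}\to[0,\infty]$ is: for $r\ne0$, $u(r)=\frac{1-q^{-N}}{q^d}\log_q\frac1r$ if $N=d$ and $u(r)=\frac{1-q^{-N}}{q^d}\frac{1}{q^{d-N}-1}\left[r^{-(d-N)}-1\right]$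 if $N\ne d$; $u(0)=\frac{1-q^{-N}}{q^d}\frac{1}{1-q^{d-N}}$ if $N>d$ and $u(0)=\infty$ if $N\le d$. *)

(* Defs.v *)
From HB Require Import structures.
From mathcomp Require Import all_boot all_order all_algebra.
From mathcomp Require Import all_classical all_reals all_analysis.
Set Implicit Arguments. Unset Strict Implicit. Unset Printing Implicit Defensive.
Import Order.TTheory GRing.Theory Num.Theory.
Local Open Scope classical_set_scope.
Local Open Scope ring_scope.

(* A copy of a Z-module, pointed at 0 (needed to build a sigma-algebra type). *)
Definition ptd (V : zmodType) : Type := V.
HB.instance Definition _ (V : zmodType) := Choice.on (ptd V).
HB.instance Definition _ (V : zmodType) := isPointed.Build (ptd V) 0.

Section Defs.
Variable R : realType.

Definition open_nv (V : zmodType) (nv : V -> R) : set (set (ptd V)) :=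
  [set U | forall x, U x -> exists e : R, 0 < e /\ [set y | nv (y - x) < e] `<=` U].

Definition borelT (V : zmodType) (nv : V -> R) := g_sigma_algebraType (open_nv nv).

Variable K : fieldType.
Variable a : K -> R.

Definition vnorm (n : nat) (x : 'rV[K]_n) : R := \big[Num.max/0]_(i < n) a (x ord0 i).

Definition local_field_abs (q : nat) (rho : K) : Prop :=
  (1 < q)%N /\
      (forall x, a x = 0 <-> x = 0) /\
      (forall x y, a (x * y) = a x * a y) /\
      (forall x y, a (x + y) <= Num.max (a x) (a y)) /\
      (forall x, x != 0 -> exists k : int, a x = (q%:R : R) ^ k) /\
      a rho = (q%:R : R)^-1 /\
      (forall u : nat -> K,
         (forall e : R, 0 < e -> exists M, forall m n, (M <= m)%N -> (M <= n)%N ->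
            a (u m - u n) < e) ->
         exists l, forall e : R, 0 < e -> exists M, forall m, (M <= m)%N -> a (u m - l) < e).

Definition DK : set K := [set x | a x <= 1].
Definition rhoD (rho : K) (n : nat) : set K := [set rho ^+ n * x | x in DK].

(* Haar measure on K normalized by lam(D) = 1; the absolute value is the normalized
   one, i.e. lam(rho D) = q^-1 (D is the union of q cosets of rho D). *)
Definition haar (q : nat) (rho : K) (lam : {measure set (borelT a) -> \bar R}) : Prop :=
  [/\ (forall (x : K) (A : set (borelT a)), measurable A ->
         lam [set x + y | y in A] = lam A),
      lam DK = 1%E &
      lam (rhoD rho 1) = ((q%:R : R)^-1)%:E].

Definition Dn (n : nat) : set 'rV[K]_n := [set x | forall i, a (x ord0 i) <= 1].

Definition coset (N : nat) (rho : K) (n : nat) (t : 'rV[K]_N) : set 'rV[K]_N :=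
  [set t + rho ^+ n *: s | s in @Dn N].
Definition is_coset (N : nat) (rho : K) (n : nat) (C : set 'rV[K]_N) : Prop :=
  exists2 t, @Dn N t & C = coset rho n t.

Definition mutually_independent (dO : measure_display) (Omega : measurableType dO)
  (P : probability Omega R) (I : Type) (valid : I -> Prop) (Y : I -> Omega -> K) : Prop :=
  forall (m : nat) (f : 'I_m -> I), injective f -> (forall k, valid (f k)) ->
  forall A : 'I_m -> set (borelT a), (forall k, measurable (A k)) ->
  P (\bigcap_(k in [set: 'I_m]) (Y (f k) @^-1` A k)) =
  (\prod_(k < m) P (Y (f k) @^-1` A k))%E.

(* the function u of the paper (only its values on {q^-k} u {0} matter) *)
Definition ufun (q N d : nat) (r : R) : \bar R :=
  let c : R := (1 - (q%:R : R) ^- N) / (q%:R : R) ^+ d in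
  if r == 0 then
    (if (d < N)%N then (c / (1 - (q%:R : R) ^ (d%:Z - N%:Z)))%:E else +oo%E)
  else if N == d then (c * (ln r^-1 / ln (q%:R : R)))%:E
  else (c / ((q%:R : R) ^ (d%:Z - N%:Z) - 1) * (r ^ (N%:Z - d%:Z) - 1))%:E.

End Defs.
Arguments Dn {R K} a n _.

(* Main.v *)
(** Put M = q^N and b = q^(d-N). Modulo rho^n the field X is a branching random walk: each
    individual at level k, sitting in a ball of radius q^-k of D^d, has M children, and each child
    independently picks one of the q^d sub-balls uniformly. Let C be a union of balls of radius q^-n
    and h(c) the probability that an individual in the ball c has a descendant in C. Then
    h(c) = 1 - (1 - p(c))^M with p(c) the average of h over the q^d sub-balls of c, so that
        1/(M p) + (M-1)/(2M) <= 1/h <= 1/(M p) + 1,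
    the recursion of the resistance of a tree network. On the other side u(|x-y|) is a constant
    times the sum of b^(k-1) over those k >= 1 for which x and y agree modulo rho^k, so the energy
    of mu is a constant times sum_k b^(k-1) sum_c mu(c)^2 over the balls c of radius q^-k, the energy
    of mu as a flow.
    The upper bound on 1/h gives mu(c)^2 <= h(c) * energy for mu carried by C; the lower bound shows
    that the flow which splits proportionally to h has energy at most a constant times 1/h(root).

    To pass to a Borel set B, Choquet's capacitability argument is applied twice, to the outer
    probability of hitting a set and to the outer measure of mu: if B is not small, there are
    decreasing unions C_n of balls of radius q^-n with intersection inside B, none of them small. *)
Require Import Defs.
From HB Require Import structures.
From mathcomp Require Import all_boot all_order all_algebra.
From mathcomp Require Import all_classical all_reals all_analysis.
From mathcomp Require Import measurable_realfun ring lra zify.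
Import Order.TTheory GRing.Theory Num.Theory.
Import numFieldNormedType.Exports.
Local Open Scope classical_set_scope.
Local Open Scope ring_scope.
Set Implicit Arguments.
Unset Strict Implicit.
Unset Printing Implicit Defensive.

(** * Capacitability of Borel sets *)

(** The set of outcomes that hit [B] is a union over uncountably many times and is never shown
    measurable. Non-polarity is therefore [~ P.-negligible], and smallness is expressed through
    measurable covers, which behave well along increasing unions of arbitrary sets. The return from
    the sets C_n to [B] rests on the compactness of D^N, in the form of Konig's lemma. The shape of
    the tree is not given directly: nothing in the axioms on [a] bounds the residue field, and the
    [q] digits come from a packing argument with the normalized Haar measure. The field starts with
    a single coset at level 0, so the probability of a hit is p(root) and not h(root). Since p <= h
    <= M p, this is harmless: only positivity uniform in the depth matters. For the same reason the
    two bounds on 1/h may differ: a level adds to 1/h a resistance between (M-1)/(2M) and 1, and the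
    former is positive because N > 0 makes M > 1. *)

Lemma konig (T : eqType) (Pr : seq T -> Prop) (br : seq T -> seq T) :
  (forall s x, Pr (rcons s x) -> Pr s) ->
  (forall s x, Pr (rcons s x) -> x \in br s) ->
  (forall n, exists2 s, size s = n & Pr s) ->
  exists g : nat -> T, forall n, Pr (mkseq g n).
Proof.
move=> Pcl Pbr Pex.
have Pcat s t : Pr (s ++ t) -> Pr s.
  elim/last_ind: t => [|t x IH]; first by rewrite cats0.
  by rewrite -rcons_cat => /Pcl.
pose Inf s := forall n, exists2 t, size t = n & Pr (s ++ t).
have step s : Inf s -> exists x, Inf (rcons s x).
  move=> Is; apply: contrapT => /forallNP nI.
  have {nI} /choice[b bP] : forall x, exists n, forall t, size t = n -> ~ Pr (rcons s x ++ t).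
    move=> x; have /existsNP[n nP] := nI x.
    by exists n => t tn Pt; apply: nP; exists t.
  (* An extension one letter longer than all the bounds [b x]: after its first letter [x] at least
     [b x] letters remain, against the choice of [b x]. *)
  have [[|x t]// [st] Pt] := Is (\max_(x <- br s) b x).+1.
  have Px : Pr (rcons s x) by apply: (Pcat _ t); rewrite cat_rcons.
  have bt : (b x <= size t)%N by rewrite st leq_bigmax_seq// Pbr.
  apply: (bP x (take (b x) t)); first by rewrite size_takel.
  by apply: (Pcat _ (drop (b x) t)); rewrite -catA cat_take_drop cat_rcons.
have I0 : Inf [::] by move=> n; have [s sn Ps] := Pex n; exists s.
have /choice[f fP] : forall s, exists x, Inf s -> Inf (rcons s x).
  move=> s; have [/step[x Ix]|nI] := pselect (Inf s); first by exists x.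
  have [[|x t]//] := Pex 1; by exists x.
pose W n := iter n (fun s => rcons s (f s)) [::].
exists (fun n => f (W n)) => n.
have -> : mkseq (fun n => f (W n)) n = W n.
  by elim: n => [//|n IH]; rewrite mkseqS IH.
have IW : Inf (W n) by elim: n => [//|n IH] /=; exact: fP.
by have [t _] := IW 0; exact: Pcat.
Qed.

Section Souslin.
Variables (V : Type) (cong : nat -> V -> V -> Prop).
Hypothesis cong_sym : forall n x y, cong n x y -> cong n y x.
Hypothesis cong_trans : forall n x y z, cong n x y -> cong n y z -> cong n x z.
Hypothesis cong_le : forall m n x y, (m <= n)%N -> cong n x y -> cong m x y.
Hypothesis cong_refl : forall n x, cong n x x.

Definition level_set n (S : set V) := forall x y, cong n x y -> S x -> S y.

Definition agree n (s t : nat -> nat) := forall i, (i < n)%N -> s i = t i.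

(* [B] is the projection of a closed subset of V * (nat -> nat), where V carries the
   topology whose basic open sets are the classes of the relations [cong n]. *)
Definition souslin (B : set V) := exists F : nat -> V -> (nat -> nat) -> Prop,
  (forall n x y s t, cong n x y -> agree n s t -> F n x s -> F n y t) /\
  (forall x, B x <-> exists s, forall n, F n x s).

Definition cong_open (U : set V) := forall x, U x -> exists n, forall y, cong n x y -> U y.

(** The entry [s 0] guesses the radius of a ball around [x] inside [U]. The guess is tested only at
    levels above [s 0], where [x] is known precisely enough and [s 0] is among the entries fixed by
    [agree]. *)
Lemma souslin_open U : cong_open U -> souslin U.
Proof.
move=> oU; exists (fun m x s => (s 0 < m)%N -> forall y, cong (s 0) x y -> U y); split.
  move=> n x y s t cxy st Fs tn z cyz.
  have s0 : s 0 = t 0 by apply: st; exact: leq_trans tn.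
  rewrite -s0 in tn cyz; apply: (Fs tn); apply: cong_trans cyz.
  by apply: cong_le cxy; exact: ltnW.
move=> x; split=> [/oU[n nU]|[s /(_ (s 0).+1) Fs]]; first by exists (fun=> n).
exact: Fs.
Qed.

Lemma souslin_closed U : cong_open U -> souslin (~` U).
Proof.
move=> oU; exists (fun m x s => exists2 y, cong m x y & ~ U y); split.
  move=> n x y s t cxy _ [z xz nUz]; exists z => //.
  by apply: cong_trans xz; exact: cong_sym.
move=> x; split=> [nU|[s Fs] /oU[n nU]]; first by exists (fun=> 0) => n; exists x.
by have [y /nU] := Fs n.
Qed.

(** The first entry of the sequence names a set containing the point and the rest is the witness for
    that set, hence the shift of levels by one. *)
Lemma souslin_bigcup (A : nat -> set V) :
  (forall n, souslin (A n)) -> souslin (\bigcup_n A n).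
Proof.
move=> /choice[F HF].
exists (fun n x s => (0 < n)%N -> F (s 0) n.-1 x (s \o succn)); split.
  move=> [//|n] x y s t cxy st Fs _; rewrite -(st 0)//.
  have [FP _] := HF (s 0); apply: FP (Fs _) => //; first exact: cong_le cxy.
  by move=> i ni /=; apply: st.
move=> x; split=> [[k _ Ak]|[s Fs]].
  have [_ /(_ x)[/(_ Ak)[s Fs] _]] := HF k.
  by exists (fun i => if i is j.+1 then s j else k) => -[//|n] _ /=; exact: Fs.
exists (s 0) => //; have [_ /(_ x)[_]] := HF (s 0); apply.
by exists (s \o succn) => n; exact: (Fs n.+1).
Qed.

(** One sequence carries a witness for every [A i], at the positions [pickle (i, k)]. The condition
    of [A i] at level [m] is imposed at level [n] only when all the entries that it reads lie below
    [n]. *)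
Lemma souslin_bigcap (A : nat -> set V) :
  (forall n, souslin (A n)) -> souslin (\bigcap_n A n).
Proof.
move=> /choice[F HF].
pose sub (s : nat -> nat) (i : nat) : nat -> nat := fun k => s (pickle (i, k)).
exists (fun n x s => forall i m, (m <= n)%N ->
   (forall k, (k < m)%N -> (pickle (i, k) < n)%N) -> F i m x (sub s i)); split.
  move=> n x y s t cxy st Fs i m mn Hk.
  have [FP _] := HF i; apply: FP (Fs i m mn Hk); first exact: cong_le cxy.
  by move=> k km; apply: st; exact: Hk.
move=> x; split=> [AA|[s Fs] i _].
  have /choice[s Hs] : forall i, exists s, forall n, F i n x s.
    by move=> i; have [_ /(_ x)[/(_ (AA i I))]] := HF i.
  exists (fun m => if unpickle m is Some p then s p.1 p.2 else 0) => n i m mn Hk.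
  have [FP _] := HF i; apply: FP (Hs i m); first exact: cong_refl.
  by move=> k km; rewrite /sub pickleK.
have [_ /(_ x)[_]] := HF i; apply; exists (sub s i) => m.
apply: (Fs (maxn m (\max_(k < m) (pickle (i, nat_of_ord k)).+1))); first exact: leq_maxl.
move=> k km; rewrite leq_max; apply/orP; right.
exact: (@leq_bigmax _ (fun k : 'I_m => (pickle (i, nat_of_ord k)).+1) (Ordinal km)).
Qed.

(** Souslin sets have no evident stability under complement, so the sigma-algebra considered is that
    of the sets which are Souslin together with their complement. *)
Lemma souslin_sigma_algebra (G : set (set V)) : (forall U, G U -> cong_open U) ->
  <<s G >> `<=` souslin.
Proof.
move=> GO A sA; suff [] : souslin A /\ souslin (~` A) by [].
apply: (sA [set A | souslin A /\ souslin (~` A)]); split => [|U GU]; last first.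
  by split; [apply: souslin_open|apply: souslin_closed]; exact: GO.
split.
- have oT : cong_open setT by move=> x _; exists 0.
  by split; [|rewrite setC0]; [rewrite -setCT; exact: souslin_closed|exact: souslin_open].
- by move=> B [sB sCB]; rewrite /= setTD setCK.
- move=> F HF; split; first by apply: souslin_bigcup => n; have [] := HF n.
  by rewrite setC_bigcup; apply: souslin_bigcap => n; have [] := HF n.
Qed.

(* Choquet's capacitability argument, for the capacities "A is not small". *)
Lemma souslin_capacitable (Q : set V -> Prop) (B : set V) :
  (forall A A', A `<=` A' -> Q A' -> Q A) ->
  (forall A : nat -> set V, (forall n, A n `<=` A n.+1) -> (forall n, Q (A n)) ->
     Q (\bigcup_n A n)) ->
  souslin B -> ~ Q B ->
  exists C : nat -> set V, [/\ forall n, level_set n (C n), forall n, C n.+1 `<=` C n,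
    \bigcap_n C n `<=` B & forall n, ~ Q (C n)].
Proof.
move=> Qsub Qcup [F [FP FB]] nQB.
(* [A s] collects the points with a witness bounded by [s] on its first entries. It is the
   increasing union of the sets [A (rcons s m)], so if it is not small, one of them is not; the
   bounds [k] are chosen this way one after another. *)
pose A (s : seq nat) : set V := [set x | exists t : nat -> nat,
  (forall i, (i < size s)%N -> (t i <= nth 0%N s i)%N) /\ forall n, F n x t].
have A0 : ~ Q (A [::]).
  by apply: contra_not nQB; apply: Qsub => x /FB[t Ft]; exists t.
have step s : ~ Q (A s) -> exists m, ~ Q (A (rcons s m)).
  move=> nQs; apply: contrapT => /forallNP nm; apply: nQs.
  apply: (@Qsub _ (\bigcup_m A (rcons s m))).
    move=> x [t [ts Ft]]; exists (t (size s)) => //; exists t; split => // i.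
    rewrite size_rcons ltnS leq_eqVlt => /orP[/eqP->|lis].
      by rewrite nth_rcons ltnn eqxx.
    by rewrite nth_rcons lis ts.
  apply: Qcup => n; last exact: contrapT.
  move=> x [t [ts Ft]]; exists t; split => // i; rewrite size_rcons => li.
  have {ts} := ts i; rewrite size_rcons !nth_rcons => /(_ li).
  by case: ltnP => // _; case: eqP => // _ /leq_trans->.
have /choice[f fP] : forall s, exists m, ~ Q (A s) -> ~ Q (A (rcons s m)).
  by move=> s; have [/step[m]|?] := pselect (~ Q (A s)); [exists m|exists 0].
pose W n := iter n (fun s => rcons s (f s)) [::].
pose k n := f (W n).
have Wk n : W n = mkseq k n.
  by elim: n => [//|n IH]; rewrite mkseqS -IH.
have nQW n : ~ Q (A (mkseq k n)) by rewrite -Wk; elim: n => [//|n IH] /=; exact: fP.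
(* Truncating the conditions at level [n] enlarges [A (mkseq k n)] to a set that depends only on
   classes modulo [cong n]. *)
exists (fun n => [set x | exists t : nat -> nat,
  (forall i, (i < n)%N -> (t i <= k i)%N) /\ forall m, (m <= n)%N -> F m x t]); split.
- move=> n x y cxy [t [tk Ft]]; exists t; split => // m mn.
  by apply: FP (Ft m mn) => //; exact: cong_le cxy.
- move=> n x [t [tk Ft]]; exists t; split=> [i li|m lm]; first by apply: tk; exact: ltnW.
  by apply: Ft; exact: ltnW.
- move=> x Cx; apply/FB.
  (* The sequences bounded by [k] form a compact set: partial witnesses of every length yield a full
     one by [konig]. *)
  pose Pr (s : seq nat) := (forall i, (i < size s)%N -> (nth 0%N s i <= k i)%N) /\
     forall m, (m <= size s)%N -> F m x (nth 0%N s).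
  have [||n|g gP] := @konig _ Pr (fun s => iota 0 (k (size s)).+1).
  + move=> s a [sk Fs]; split=> [i li|m lm].
      have := sk i; rewrite size_rcons nth_rcons li; apply; exact: ltnW.
    have Fm : F m x (nth 0%N (rcons s a)) by apply: Fs; rewrite size_rcons ltnW.
    apply: FP Fm; first exact: cong_refl.
    by move=> i im; rewrite nth_rcons (leq_trans im lm).
  + move=> s a [sk _]; have := sk (size s).
    by rewrite size_rcons nth_rcons ltnn eqxx mem_iota/= add0n ltnS; exact.
  + have [t [tk Ft]] := Cx n I; exists (mkseq t n); first by rewrite size_mkseq.
    split=> [i|m]; rewrite size_mkseq => lm; first by rewrite nth_mkseq// tk.
    apply: FP (Ft m lm); first exact: cong_refl.
    by move=> i im; rewrite nth_mkseq// (leq_trans im lm).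
  + exists g => n; have [_ /(_ n)] := gP n; rewrite size_mkseq => /(_ (leqnn _)).
    by apply: FP; [exact: cong_refl|move=> i li; rewrite nth_mkseq].
- move=> n; apply: contra_not (nQW n); apply: Qsub => x [t [tk Ft]]; exists t.
  split => // i li; have := tk i; rewrite size_mkseq nth_mkseq//; exact.
Qed.

End Souslin.

(** * The local field *)

Section LocalField.
Variables (R : realType) (K : fieldType) (a : K -> R) (q : nat) (rho : K).
Hypothesis HK : local_field_abs a q rho.

Local Notation qe n := ((q%:R : R) ^- n).

Lemma q_gt1 : (1 < q)%N. Proof. by case: HK. Qed.
Lemma qR_gt1 : 1 < q%:R :> R. Proof. by rewrite ltr1n q_gt1. Qed.
Lemma qR_gt0 : 0 < q%:R :> R. Proof. exact: lt_trans ltr01 qR_gt1. Qed.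
Lemma qR_neq0 : q%:R != 0 :> R. Proof. by rewrite gt_eqF// qR_gt0. Qed.
Lemma qe_gt0 n : 0 < qe n. Proof. by rewrite invr_gt0 exprn_gt0// qR_gt0. Qed.
Lemma qe_ge0 n : 0 <= qe n. Proof. exact/ltW/qe_gt0. Qed.
Lemma qeS n : qe n.+1 = q%:R^-1 * qe n. Proof. by rewrite exprS invfM. Qed.
Lemma qe_le m n : (m <= n)%N -> qe n <= qe m.
Proof.
by move=> mn; rewrite lef_pV2 ?posrE ?exprn_gt0 ?qR_gt0// ler_eXn2l// qR_gt1.
Qed.

Lemma qe_lt_eps (e : R) : 0 < e -> exists n, qe n < e.
Proof.
move=> e0; have [n ne] : exists n, e^-1 < q%:R ^+ n.
  exists (Num.bound e^-1); apply: lt_le_trans (_ : (Num.bound e^-1)%:R <= _).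
    by apply: archi_boundP; rewrite invr_ge0 ltW.
  rewrite -natrX ler_nat; apply: ltnW; apply: ltn_expl; exact: q_gt1.
by exists n; rewrite -[e]invrK ltf_pV2 ?posrE ?invr_gt0 ?exprn_gt0 ?qR_gt0.
Qed.

Lemma a_eq0 x : (a x = 0) <-> (x = 0). Proof. by case: HK => _ []. Qed.
Lemma a0 : a 0 = 0. Proof. exact/a_eq0. Qed.
Lemma aM x y : a (x * y) = a x * a y. Proof. by case: HK => _ [_ []]. Qed.
Lemma a_ultra x y : a (x + y) <= Num.max (a x) (a y).
Proof. by case: HK => _ [_ [_ []]]. Qed.
Lemma a_val x : x != 0 -> exists k : int, a x = (q%:R : R) ^ k.
Proof. by case: HK => _ [_ [_ [_ []]]] h _; exact: h. Qed.
Lemma a_rho : a rho = (q%:R : R)^-1. Proof. by case: HK => _ [_ [_ [_ [_ []]]]]. Qed.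
Lemma rho_neq0 : rho != 0.
Proof.
apply/eqP => r0; have := a_rho; rewrite r0 a0 => /esym/eqP.
by rewrite invr_eq0 (negbTE qR_neq0).
Qed.

Lemma a_ge0 x : 0 <= a x.
Proof.
have [->|/a_val[k ->]] := eqVneq x 0; first by rewrite a0.
by apply: exprz_ge0; exact: ltW qR_gt0.
Qed.

Lemma a1 : a 1 = 1.
Proof.
have a1n : a 1 != 0 by apply/eqP => /a_eq0/eqP; rewrite oner_eq0.
by apply: (mulfI a1n); rewrite -aM !mulr1.
Qed.

Lemma aN x : a (- x) = a x.
Proof.
have aN1 : a (-1) = 1.
  have : a (-1) ^+ 2 = 1 by rewrite expr2 -aM mulrNN mulr1 a1.
  by move/eqP; rewrite sqrf_eq1 => /orP[/eqP//|/eqP aN1]; have := a_ge0 (-1); rewrite aN1 ler0N1.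
by rewrite -mulN1r aM aN1 mul1r.
Qed.

Lemma aX x n : a (x ^+ n) = a x ^+ n.
Proof. by elim: n => [|n IH]; [rewrite !expr0 a1|rewrite !exprS aM IH]. Qed.

Lemma a_rhoX n : a (rho ^+ n) = qe n. Proof. by rewrite aX a_rho exprVn. Qed.

Lemma a_addle e x y : a x <= e -> a y <= e -> a (x + y) <= e.
Proof. by move=> xe ye; apply: le_trans (a_ultra x y) _; rewrite ge_max xe ye. Qed.

Lemma a_subC x y : a (x - y) = a (y - x). Proof. by rewrite -aN opprB. Qed.

(** The value group is discrete: nothing lies strictly between consecutive powers of [q]. *)
Lemma a_lt1 n x : a x < qe n -> a x <= qe n.+1.
Proof.
have [->|/a_val[k ->]] := eqVneq x 0; first by rewrite a0 => _; exact: qe_ge0.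
rewrite !exprnN ltr_eXz2l ?qR_gt1// ler_eXz2l ?qR_gt1//; lia.
Qed.

Lemma vnorm_le e (x : 'rV[K]_e) (r : R) : 0 <= r ->
  (vnorm a x <= r) <-> (forall i, a (x ord0 i) <= r).
Proof.
move=> r0; split=> [/bigmax_leP[_ h] i|h]; first exact: h.
by apply/bigmax_leP; split.
Qed.

Lemma vnorm_lt e (x : 'rV[K]_e) (r : R) : 0 < r ->
  (vnorm a x < r) <-> (forall i, a (x ord0 i) < r).
Proof.
move=> r0; split=> [/bigmax_ltP[_ h] i|h]; first exact: h.
by apply/bigmax_ltP; split.
Qed.

Definition cong e n (x y : 'rV[K]_e) := forall i, a (x ord0 i - y ord0 i) <= qe n.

Lemma cong_refl e n (x : 'rV[K]_e) : cong n x x.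
Proof. by move=> i; rewrite subrr a0 qe_ge0. Qed.
Lemma cong_sym e n (x y : 'rV[K]_e) : cong n x y -> cong n y x.
Proof. by move=> xy i; rewrite a_subC. Qed.
Lemma cong_trans e n (x y z : 'rV[K]_e) : cong n x y -> cong n y z -> cong n x z.
Proof.
move=> xy yz i; have -> : x ord0 i - z ord0 i = (x ord0 i - y ord0 i) + (y ord0 i - z ord0 i).
  by rewrite addrA subrK.
exact: a_addle.
Qed.
Lemma cong_le e m n (x y : 'rV[K]_e) : (m <= n)%N -> cong n x y -> cong m x y.
Proof. by move=> mn xy i; apply: le_trans (xy i) (qe_le mn). Qed.
Lemma congD e n (x y x' y' : 'rV[K]_e) : cong n x y -> cong n x' y' -> cong n (x + x') (y + y').
Proof. by move=> xy xy' i; rewrite !mxE opprD addrACA a_addle. Qed.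
Lemma congZ e m n (x y : 'rV[K]_e) : cong n (rho ^+ m *: x) (rho ^+ m *: y) <->
  (forall i, qe m * a (x ord0 i - y ord0 i) <= qe n).
Proof. by split=> xy i; have := xy i; rewrite !mxE -mulrBr aM a_rhoX. Qed.
Lemma congZD e m n (x y : 'rV[K]_e) : cong (m + n) (rho ^+ m *: x) (rho ^+ m *: y) <-> cong n x y.
Proof.
rewrite congZ; split=> xy i; have := xy i; rewrite exprD invfM ler_pM2l ?qe_gt0//.
Qed.
Lemma cong_Dn e n (x y : 'rV[K]_e) : cong n x y -> Dn a e x -> Dn a e y.
Proof.
move=> xy Dx i; rewrite -[y ord0 i](subrK (x ord0 i)); apply: a_addle => //.
rewrite a_subC; apply: le_trans (xy i) _; have := qe_le (leq0n n).
by rewrite expr0 invr1.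
Qed.
Lemma cong_vnorm e n (x y : 'rV[K]_e) : cong n x y <-> vnorm a (x - y) <= qe n.
Proof. by rewrite vnorm_le ?qe_ge0//; split=> xy i; have := xy i; rewrite !mxE. Qed.
Lemma vnorm_cong e n (x y : 'rV[K]_e) : vnorm a (y - x) < qe n -> cong n x y.
Proof. by move=> /ltW/cong_vnorm; exact: cong_sym. Qed.
Lemma cong0_Dn e (x : 'rV[K]_e) : Dn a e x <-> cong 0 x 0.
Proof. by split=> h i; have := h i; rewrite !mxE subr0 expr0 invr1. Qed.

Lemma open_cong_open e (U : set 'rV[K]_e) : open_nv (@vnorm R K a e) U ->
  cong_open (@cong e) U.
Proof.
move=> oU x /oU[r [r0 rU]]; have [n nr] := qe_lt_eps r0; exists n => y /cong_sym/cong_vnorm xy.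
by apply: rU; exact: le_lt_trans nr.
Qed.

Lemma cong_open_open e (U : set 'rV[K]_e) : cong_open (@cong e) U ->
  open_nv (@vnorm R K a e) U.
Proof.
move=> oU x /oU[n nU]; exists (qe n); split; first exact: qe_gt0.
by move=> y /= /vnorm_cong; exact: nU.
Qed.

Lemma level_set_open e n (U : set 'rV[K]_e) : level_set (@cong e) n U -> cong_open (@cong e) U.
Proof. by move=> lU x Ux; exists n => y xy; exact: lU Ux. Qed.

Lemma measurable_level e n (U : set 'rV[K]_e) : level_set (@cong e) n U ->
  measurable (U : set (borelT (@vnorm R K a e))).
Proof. by move=> lU; apply: sub_sigma_algebra; apply: cong_open_open; exact: level_set_open lU. Qed.

Lemma level_ball e n (x : 'rV[K]_e) : level_set (@cong e) n [set y | cong n y x].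
Proof. by move=> y z yz /= yx; apply: cong_trans yx; exact: cong_sym. Qed.

Lemma level_Dn e n : level_set (@cong e) n (Dn a e).
Proof. by move=> x y; exact: cong_Dn. Qed.

(** * Digit expansions *)

Variable r : 'I_q -> K.
Definition residue_system := [/\ forall i, a (r i) <= 1,
  forall x, a x <= 1 -> exists i, a (x - r i) <= qe 1 &
  forall i j, a (r i - r j) <= qe 1 -> i = j].
Hypothesis Hr : residue_system.

Let r_int i : a (r i) <= 1. Proof. by case: Hr. Qed.
Let r_ex x : a x <= 1 -> exists i, a (x - r i) <= qe 1.
Proof. by case: Hr => _ + _; exact. Qed.
Let r_inj i j : a (r i - r j) <= qe 1 -> i = j.
Proof. by case: Hr => _ _; exact. Qed.

Definition digit e := {ffun 'I_e -> 'I_q}.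
Definition vrep e (i : digit e) : 'rV[K]_e := \row_j r (i j).
(** Horner form of c_0 + rho c_1 + rho^2 c_2 + ...: a word of size [n] names a ball of radius q^-n
    in D^e, and its prefixes name the larger balls around it. *)
Definition pt e (c : seq (digit e)) : 'rV[K]_e := foldr (fun i x => vrep i + rho *: x) 0 c.

Lemma card_digit e : #|{: digit e}| = (q ^ e)%N.
Proof. by rewrite card_ffun !card_ord. Qed.

Lemma vrep_Dn e (i : digit e) : Dn a e (vrep i).
Proof. by move=> j; rewrite mxE. Qed.

Lemma DnD e (x y : 'rV[K]_e) : Dn a e x -> Dn a e y -> Dn a e (x + y).
Proof. by move=> Dx Dy i; rewrite mxE a_addle. Qed.

Lemma DnZ e n (x : 'rV[K]_e) : Dn a e x -> Dn a e (rho ^+ n *: x).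
Proof.
move=> Dx i; rewrite mxE aM a_rhoX mulr_ile1 ?qe_ge0 ?a_ge0//.
by have := qe_le (leq0n n); rewrite expr0 invr1.
Qed.

Lemma pt_Dn e (c : seq (digit e)) : Dn a e (pt c).
Proof.
elim: c => [|i c IH] /=; first by move=> i; rewrite mxE a0.
by apply: DnD; [exact: vrep_Dn|rewrite -[rho]expr1; exact: DnZ].
Qed.

Lemma pt_cat e (c c' : seq (digit e)) : pt (c ++ c') = pt c + rho ^+ size c *: pt c'.
Proof.
elim: c => [|i c IH] /=; first by rewrite add0r scale1r.
by rewrite IH scalerDr addrA scalerA -exprS.
Qed.

Lemma rho_cong e n (x y z : 'rV[K]_e) : Dn a e y -> z = x + rho ^+ n *: y -> cong n z x.
Proof.
move=> Dy -> i; rewrite !mxE addrAC subrr add0r aM a_rhoX.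
by rewrite ler_piMr ?qe_ge0.
Qed.

Lemma cong_rho e n (x z : 'rV[K]_e) : cong n z x -> exists2 y, Dn a e y & z = x + rho ^+ n *: y.
Proof.
move=> zx; exists (rho ^- n *: (z - x)); last first.
  by rewrite scalerA mulfV ?expf_neq0 ?rho_neq0// scale1r addrC subrK.
move=> i; have := zx i; rewrite !mxE aM => h.
have aV : a (rho ^- n) = q%:R ^+ n.
  have h0 : a (rho ^- n) * qe n = 1 by rewrite -a_rhoX -aM mulVf ?a1// expf_neq0 ?rho_neq0.
  by apply: (mulIf (lt0r_neq0 (qe_gt0 n))); rewrite h0 mulfV// expf_neq0 ?qR_neq0.
by rewrite aV mulrC -ler_pdivlMr ?exprn_gt0 ?qR_gt0// div1r.
Qed.

Lemma pt_take e n (c : seq (digit e)) : (n <= size c)%N -> cong n (pt c) (pt (take n c)).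
Proof.
move=> nc; apply: (@rho_cong _ _ _ (pt (drop n c))); first exact: pt_Dn.
by rewrite -{1}(cat_take_drop n c) pt_cat size_takel.
Qed.

Lemma vrep_inj e (i j : digit e) : cong 1 (vrep i) (vrep j) -> i = j.
Proof. by move=> ij; apply/ffunP => k; apply: r_inj; have := ij k; rewrite !mxE. Qed.

Lemma vrep_ex e (x : 'rV[K]_e) : Dn a e x -> exists i, cong 1 x (vrep i).
Proof.
move=> Dx; have /choice[f fP] : forall j, exists i, a (x ord0 j - r i) <= qe 1.
  by move=> j; exact: r_ex.
by exists [ffun j => f j] => j; rewrite mxE ffunE.
Qed.

Lemma word_ex e n (x : 'rV[K]_e) : Dn a e x -> exists2 c, size c = n & cong n x (pt c).
Proof.
elim: n x => [|n IH] x Dx; first by exists [::] => //; apply/cong0_Dn.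
have [i xi] := vrep_ex Dx; have [y Dy ->] := cong_rho xi.
have [c cn yc] := IH y Dy; exists (i :: c); first by rewrite /= cn.
rewrite /= expr1; apply: congD; first exact: cong_refl.
by rewrite -[rho]expr1 -[n.+1]add1n congZD.
Qed.

Lemma word_inj e n (c c' : seq (digit e)) : size c = n -> size c' = n ->
  cong n (pt c) (pt c') -> c = c'.
Proof.
elim: n c c' => [|n IH] [|i c] [|j c']//= [sc] [sc'] cc'.
have ij : i = j.
  apply: vrep_inj; have := cong_le (ltn0Sn n) cc'.
  have h k (d : seq (digit e)) : cong 1 (vrep k + rho *: pt d) (vrep k).
    by apply: (@rho_cong _ _ _ (pt d)) => //; exact: pt_Dn.
  by move=> ccc; apply: cong_trans (cong_trans (cong_sym (h _ _)) ccc) (h _ _).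
rewrite -{}ij in cc' *; congr cons; apply: IH => //.
have := congD (cong_refl n.+1 (- vrep i)) cc'.
by rewrite !addrA addNr !add0r -[rho]expr1 -[n.+1]add1n congZD.
Qed.

(* Equal to [[::]] when [x] is not integral. *)
Definition wcode e n (x : 'rV[K]_e) : seq (digit e) :=
  xget [::] [set c | size c = n /\ cong n x (pt c)].

Lemma wcodeP e n (x : 'rV[K]_e) : Dn a e x -> size (wcode n x) = n /\ cong n x (pt (wcode n x)).
Proof.
move=> /(@word_ex _ n)[c cn xc]; rewrite /wcode.
by apply: (@xgetPex _ [::] [set c | size c = n /\ cong n x (pt c)]); exists c.
Qed.

Lemma size_wcode e n (x : 'rV[K]_e) : Dn a e x -> size (wcode n x) = n.
Proof. by case/(wcodeP n). Qed.

Lemma cong_wcode e n (x : 'rV[K]_e) : Dn a e x -> cong n x (pt (wcode n x)).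
Proof. by case/(wcodeP n). Qed.

Lemma wcode_uniq e n (x : 'rV[K]_e) c : size c = n -> cong n x (pt c) -> wcode n x = c.
Proof.
move=> cn xc; have Dx : Dn a e x by apply: cong_Dn (cong_sym xc) (pt_Dn _).
apply: (word_inj (size_wcode n Dx) cn); apply: cong_trans xc.
by apply: cong_sym; exact: cong_wcode.
Qed.

Lemma wcode_cong e n (x y : 'rV[K]_e) : Dn a e x -> Dn a e y ->
  (wcode n x = wcode n y) <-> cong n x y.
Proof.
move=> Dx Dy; split=> [xy|xy].
  by apply: cong_trans (cong_wcode n Dx) _; rewrite xy; apply: cong_sym; exact: cong_wcode.
apply: wcode_uniq; first exact: size_wcode.
by apply: cong_trans xy _; exact: cong_wcode.
Qed.

Lemma take_wcode e m n (x : 'rV[K]_e) : Dn a e x -> (m <= n)%N -> take m (wcode n x) = wcode m x.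
Proof.
move=> Dx mn; apply/esym/wcode_uniq; first by rewrite size_takel// size_wcode.
apply: cong_trans (cong_le mn (cong_wcode n Dx)) _.
by apply: pt_take; rewrite size_wcode.
Qed.

Lemma wcode_rcons e n (x : 'rV[K]_e) : Dn a e x ->
  exists i, wcode n.+1 x = rcons (wcode n x) i.
Proof.
move=> Dx; have := take_wcode Dx (leqnSn n); have := size_wcode n.+1 Dx.
case/lastP: (wcode n.+1 x) => [//|c i]; rewrite size_rcons => -[cn].
by rewrite -cats1 takel_cat ?cn// -{1}cn take_size => <-; exists i; rewrite cats1.
Qed.

(** The points of the words [mkseq g n] form a Cauchy sequence, and the completeness in
    [local_field_abs] gives its limit coordinate by coordinate. Infinite branches of the tree thus
    correspond to points. *)
Lemma branch_limit e (g : nat -> digit e) :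
  exists2 x, Dn a e x & forall n, wcode n x = mkseq g n.
Proof.
pose u n := pt (mkseq g n).
have uu m n : (m <= n)%N -> cong m (u n) (u m).
  move=> mn; have tg : take m (mkseq g n) = mkseq g m.
    by rewrite -map_take take_iota (minn_idPl mn).
  by rewrite /u -tg; apply: pt_take; rewrite size_mkseq.
have /choice[l lP] : forall i, exists l, forall n, a (u n ord0 i - l) <= qe n.
  move=> i; have [] : exists l, forall e : R, 0 < e ->
      exists M, forall m, (M <= m)%N -> a (u m ord0 i - l) < e.
    case: HK => _ [_ [_ [_ [_ [_]]]]]; apply.
    move=> e0 /qe_lt_eps[M Me]; exists M => m n Mm Mn; apply: le_lt_trans Me.
    rewrite -[u m ord0 i](subrK (u M ord0 i)) -addrA; apply: a_addle; first exact: uu.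
    by rewrite a_subC; exact: uu.
  move=> l lP; exists l => n; have [M MP] := lP _ (qe_gt0 n).
  have {MP} := MP (maxn M n) (leq_maxl _ _) => /ltW h.
  have := uu n (maxn M n) (leq_maxr _ _); move=> /(_ i); rewrite a_subC => h'.
  by have := a_addle h' h; rewrite addrA subrK.
have ul n : cong n (\row_i l i) (u n) by move=> i; rewrite !mxE a_subC.
exists (\row_i l i); first by apply: cong_Dn (cong_sym (ul 0)) _; exact: pt_Dn.
by move=> n; apply: wcode_uniq; [rewrite size_mkseq|exact: ul].
Qed.

End LocalField.

(** * Haar measure of balls *)

Lemma measure_finU d (T : measurableType d) (R : realType) (mu : {measure set T -> \bar R})
    (I : finType) (P : pred I) (F : I -> set T) (A : set T) :
  (forall i, P i -> measurable (F i)) ->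
  (forall i j x, P i -> P j -> F i x -> F j x -> i = j) ->
  (forall x, A x <-> exists2 i, P i & F i x) ->
  measurable A /\ mu A = (\sum_(i | P i) mu (F i))%E.
Proof.
move=> mF disj AF.
suff H (s : seq I) : uniq s -> all P s ->
    measurable [set x | exists2 i, i \in s & F i x] /\
    mu [set x | exists2 i, i \in s & F i x] = (\sum_(i <- s) mu (F i))%E.
  have -> : A = [set x | exists2 i, i \in enum P & F i x].
    apply/seteqP; split=> x; first by move=> /AF[i Pi Fi]; exists i => //; rewrite mem_enum.
    by move=> [i]; rewrite mem_enum => Pi Fi; apply/AF; exists i.
  have [||mA ->] := H (enum P); rewrite ?enum_uniq//.
    by apply/allP => i; rewrite mem_enum.
  by split; rewrite // big_enum.
elim: s => [_ _|i s IH /= /andP[nis us] /andP[Pi Ps]].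
  have -> : [set x | exists2 i, i \in [::] & F i x] = set0 by apply/seteqP; split => x // [].
  by rewrite big_nil measure0; split; first exact: measurable0.
have [mS muS] := IH us Ps.
have -> : [set x | exists2 k, k \in i :: s & F k x] = F i `|` [set x | exists2 k, k \in s & F k x].
  apply/seteqP; split=> x.
    by move=> [k]; rewrite inE => /orP[/eqP-> Fx|ks Fx]; [left|right; exists k].
  move=> [Fx|[k ks Fx]]; first by exists i => //; rewrite mem_head.
  by exists k => //; rewrite inE ks orbT.
split; first by apply: measurableU => //; exact: mF.
rewrite measureU//; [by rewrite big_cons; congr (_ + _)%E|exact: mF|].
apply/seteqP; split => x // [Fx [k ks Fkx]].
have := disj i k x Pi (allP Ps _ ks) Fx Fkx; by move=> ik; rewrite ik ks in nis.
Qed.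

Section Haar.
Variables (R : realType) (K : fieldType) (a : K -> R) (q : nat) (rho : K).
Hypothesis HK : local_field_abs a q rho.
Variable lam : {measure set (borelT a) -> \bar R}.
Hypothesis Hlam : haar q rho lam.

Local Notation qe n := ((q%:R : R) ^- n).

Definition kball n (x : K) : set K := [set y | a (y - x) <= qe n].

Lemma measurable_kball n x : measurable (kball n x : set (borelT a)).
Proof.
apply: sub_sigma_algebra => y xy; exists (qe n); split; first exact: (qe_gt0 HK).
by move=> z /= /ltW zy; rewrite /kball/= -[z](subrK y) -addrA; apply: (a_addle HK).
Qed.

Lemma kball_rhoD n : kball n 0 = rhoD a rho n.
Proof.
apply/seteqP; split=> x; rewrite /kball/= subr0 => h; last first.
  by case: h => y Dy <-; rewrite (aM HK) (a_rhoX HK) ler_piMr ?(qe_ge0 HK).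
have rn : rho ^+ n != 0 by rewrite expf_neq0// (rho_neq0 HK).
exists (rho ^- n * x); last by rewrite mulrA mulfV// mul1r.
rewrite /DK/= -(ler_pM2l (qe_gt0 HK n)) mulr1 -(a_rhoX HK) -(aM HK) mulrA mulfV// mul1r.
by rewrite (a_rhoX HK).
Qed.

Lemma lam_kball n x : lam (kball n x) = lam (kball n 0).
Proof.
have [/(_ x (kball n 0) (measurable_kball n 0))<- _ _] := Hlam; congr (lam _).
apply/seteqP; split=> y; rewrite /kball/=; last first.
  by move=> [z]; rewrite subr0 => h <-; rewrite addrAC subrr add0r.
by move=> h; exists (y - x); rewrite ?subr0// addrC subrK.
Qed.

Lemma lam_kball0 : lam (kball 0 0) = 1%E.
Proof.
case: Hlam => _ <- _; congr (lam _); rewrite kball_rhoD.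
by apply/seteqP; split=> [x [y Dy <-]|x Dx]; [|exists x => //]; rewrite expr0 mul1r.
Qed.

Lemma lam_kball1 x : lam (kball 1 x) = ((q%:R : R)^-1)%:E.
Proof. by rewrite lam_kball kball_rhoD; case: Hlam. Qed.

Lemma kball_disj n x y z : kball n x z -> kball n y z -> kball n x y.
Proof.
rewrite /kball/= => xz yz; rewrite -[y](subrK z) -addrA; apply: (a_addle HK) => //.
by rewrite (a_subC HK).
Qed.

(** Packing: pairwise incongruent integral elements are centres of disjoint balls of measure q^-1
    inside D, of measure 1, so there are at most [q] of them. A system of maximal size covers D,
    which forces its size to be exactly [q]. *)
Lemma residue_system_ex : exists r : 'I_q -> K, residue_system a r.
Proof.
pose sys m := exists r : 'I_m -> K, (forall i, a (r i) <= 1) /\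
  forall i j, a (r i - r j) <= qe 1 -> i = j.
have q0 := qR_gt0 HK.
have meas m (r : 'I_m -> K) : (forall i j, a (r i - r j) <= qe 1 -> i = j) ->
    let A := [set x | exists2 i, true & kball 1 (r i) x] in
    measurable (A : set (borelT a)) /\ lam A = (m%:R / q%:R)%:E.
  move=> rinj A.
  have [||x|mA ->] := @measure_finU _ _ _ lam _ xpredT (fun i => kball 1 (r i)) A.
  - by move=> i _; exact: measurable_kball.
  - by move=> i j x _ _ /= ix jx; apply/esym/rinj; exact: kball_disj ix jx.
  - by [].
  split=> //; under eq_bigr do rewrite lam_kball1.
  by rewrite sumEFin big_const_ord iter_addr addr0 mulr_natl.
have ball01 x y : a x <= 1 -> kball 1 x y -> kball 0 0 y.
  rewrite /kball/= subr0 => x1 yx; rewrite -[y](subrK x) expr0 invr1; apply: (a_addle HK) => //.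
  by apply: le_trans yx _; have := qe_le HK (leq0n 1); rewrite expr0 invr1.
have ub m : sys m -> (m <= q)%N.
  move=> [r [r1 rinj]]; have [mA lA] := meas m r rinj.
  have : (lam [set x | exists2 i, true & kball 1 (r i) x] <= lam (kball 0 0))%E.
    apply: le_measure; rewrite ?inE//; first exact: measurable_kball.
    by move=> y [i _]; exact: ball01.
  by rewrite lA lam_kball0 lee_fin ler_pdivrMr// mul1r ler_nat.
have [m /asboolP sm mmax] : exists2 m, `[< sys m >] & forall k, `[< sys k >] -> (k <= m)%N.
  have sex : exists m, `[< sys m >].
    by exists 0; apply/asboolP; exists (fun=> 0); split=> -[].
  have sub k : `[< sys k >] -> (k <= q)%N by move=> /asboolP/ub.
  by case: (ex_maxnP sex sub) => m sm mm; exists m.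
have [r [r1 rinj]] := sm.
have rex x : a x <= 1 -> exists i, a (x - r i) <= qe 1.
  move=> x1; apply: contrapT => /forallNP nx.
  have /mmax : `[< sys m.+1 >]; last by rewrite ltnn.
  apply/asboolP; exists (fun i => if unlift ord_max i is Some j then r j else x); split.
    by move=> i; case: unliftP => [j|] _.
  move=> i j; case: unliftP => [i' ->|->]; case: unliftP => [j' ->|->] //.
  - by move=> /rinj->.
  - by rewrite (a_subC HK) => /nx.
  - by move=> /nx.
have mq : m = q.
  have [mA] := meas m r rinj.
  have -> : [set x | exists2 i, true & kball 1 (r i) x] = kball 0 0.
    apply/seteqP; split=> y; first by move=> [i _]; exact: ball01.
    by rewrite /kball/= subr0 expr0 invr1 => /rex[i]; exists i.
  rewrite lam_kball0 => -[] /esym/eqP; rewrite -(inj_eq (mulIf (lt0r_neq0 q0))).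
  by rewrite mul1r mulfVK ?(lt0r_neq0 q0)// eqr_nat => /eqP.
by move: r r1 rex rinj {sm mmax}; rewrite mq => r r1 rex rinj; exists r; split.
Qed.

(** The ball of radius q^-n is a disjoint union of [q] translates of the ball of radius q^-(n+1). *)
Lemma lam_kballE n x : lam (kball n x) = (qe n)%:E.
Proof.
have [r [r1 rex rinj]] := residue_system_ex.
elim: n x => [|n IH] x; first by rewrite lam_kball lam_kball0 expr0 invr1.
rewrite lam_kball.
have q0 := qR_gt0 HK; have e0 := qe_gt0 HK n.
have rn : rho ^+ n != 0 by rewrite expf_neq0// (rho_neq0 HK).
have S z : a (rho ^+ n * z) <= qe n.+1 <-> a z <= qe 1.
  by rewrite (aM HK) (a_rhoX HK) -addn1 exprD invfM ler_pM2l.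
have [||y|_] := @measure_finU _ _ _ lam _ xpredT (fun i => kball n.+1 (rho ^+ n * r i)) (kball n 0).
- by move=> i _; exact: measurable_kball.
- move=> i j y _ _ /= iy jy; apply: rinj; apply/S; rewrite mulrBr (a_subC HK) -/(kball _ _ _).
  exact: kball_disj iy jy.
- split=> [|[i _]].
    rewrite kball_rhoD => -[z Dz <-]; have [i zi] := rex _ Dz; exists i => //.
    by rewrite /kball/= -mulrBr; apply/S.
  rewrite /kball/= subr0 => h; rewrite -[y](subrK (rho ^+ n * r i)); apply: (a_addle HK).
    by apply: le_trans h (qe_le HK (leqnSn n)).
  by rewrite (aM HK) (a_rhoX HK) ler_piMr// ltW.
rewrite IH; under eq_bigr do rewrite lam_kball.
(* Finiteness comes before the equation can be solved for this measure in the extended reals. *)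
have fb : (lam (kball n.+1 0) \is a fin_num).
  rewrite ge0_fin_numE//; apply: (@le_lt_trans _ _ (lam (kball n 0))); last by rewrite IH ltry.
  apply: le_measure; rewrite ?inE; [exact: measurable_kball|exact: measurable_kball|].
  by move=> y; rewrite /kball/= => h; apply: le_trans h (qe_le HK (leqnSn n)).
rewrite -(fineK fb) sumEFin big_const_ord iter_addr addr0 => -[] nE.
congr EFin; rewrite qeS nE -(mulr_natl (fine _)) mulKf //; exact: (qR_neq0 HK).
Qed.

End Haar.

(** * Hitting probabilities and energies on a tree *)

Section TreeRecursion.
Variables (R : realType) (Q : finType) (M : nat).
Hypothesis Q_gt0 : (0 < #|Q|)%N.
Hypothesis M_gt1 : (1 < M)%N.

Definition avg (f : Q -> R) : R := (\sum_i f i) / #|Q|%:R.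

(* [survive p] is the probability that at least one of M independent individuals,
   each successful with probability [p], succeeds. *)
Definition survive (p : R) : R := 1 - (1 - p) ^+ M.

Fixpoint hitp (L : seq Q -> bool) (j : nat) (c : seq Q) : R :=
  if j is j'.+1 then survive (avg (fun i => hitp L j' (rcons c i))) else (L c)%:R.

Definition brate : R := #|Q|%:R / M%:R.

Let m_gt0 : 0 < #|Q|%:R :> R. Proof. by rewrite ltr0n. Qed.
Let M_gt0 : 0 < M%:R :> R. Proof. by rewrite ltr0n ltnW. Qed.

Lemma brate_gt0 : 0 < brate. Proof. exact: divr_gt0. Qed.

Lemma sum_avg f : \sum_i f i = #|Q|%:R * avg f.
Proof. by rewrite mulrC divfK// gt_eqF. Qed.

Lemma avg_ge0 f : (forall i, 0 <= f i) -> 0 <= avg f.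
Proof. by move=> f0; rewrite divr_ge0 ?sumr_ge0// ltW. Qed.

Lemma avg_le f g : (forall i, f i <= g i) -> avg f <= avg g.
Proof. by move=> fg; rewrite ler_wpM2r ?invr_ge0 ?(ltW m_gt0)// ler_sum. Qed.

Lemma avg_cst x : avg (fun=> x) = x.
Proof. by rewrite /avg sumr_const -[x *+ _]mulr_natr mulfK// gt_eqF. Qed.

Lemma avg_le1 f : (forall i, f i <= 1) -> avg f <= 1.
Proof. by move=> f1; rewrite -[leRHS]avg_cst avg_le. Qed.

Section Survive.
Variable p : R.
Hypothesis p01 : 0 <= p <= 1.
Let p0 : 0 <= p. Proof. by case/andP: p01. Qed.
Let p1 : p <= 1. Proof. by case/andP: p01. Qed.

Lemma survive_ge0 : 0 <= survive p.
Proof. by rewrite subr_ge0 exprn_ile1// ?subr_ge0// lerBlDr lerDl. Qed.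

Lemma survive_le1 : survive p <= 1.
Proof. by rewrite lerBlDr lerDl exprn_ge0// subr_ge0. Qed.

Lemma survive_ge : p <= survive p.
Proof.
rewrite lerBrDr -lerBrDl -{2}[1 - p]expr1 ler_wiXn2l ?subr_ge0//; last exact: ltnW.
by rewrite lerBlDr lerDl.
Qed.

(** This is 1/h <= 1/(M p) + 1 without denominators. The bound [pow] passes from n to n+1 because (1
    - p)(1 + (n+1) p) = 1 + n p - (n+1) p^2. *)
Lemma survive_lower : M%:R * p <= survive p * (1 + M%:R * p).
Proof.
have pow n : (1 - p) ^+ n * (1 + n%:R * p) <= 1.
  elim: n => [|n IH]; first by rewrite expr0 mul1r mul0r addr0.
  apply: le_trans IH; rewrite exprS -mulrA [in leLHS]mulrCA ler_wpM2l ?exprn_ge0 ?subr_ge0//.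
  have n0 : 0 <= n%:R :> R by [].
  rewrite -natr1; nra.
by have := pow M; rewrite /survive; lra.
Qed.

(* The second-order term is what bounds the resistance [1 / survive p] from below. *)
Lemma survive_upper : survive p * (1 + (M%:R - 1) / 2 * p) <= M%:R * p.
Proof.
(* The quotient of the two linear factors is the [1/1] Pade approximant of (1 - p)^(n+1): both sides
   agree to second order in p, and the inductive step leaves a cubic remainder. *)
have pow n : 1 - (n.+1%:R + 1) / 2 * p <= (1 - p) ^+ n.+1 * (1 + n%:R / 2 * p).
  elim: n => [|n IH]; first by rewrite expr1 mul0r mul0r addr0 mulr1; lra.
  have n0 : 0 <= n%:R :> R by [].
  move: IH; rewrite -[n.+2%:R]natr1 -[n.+1%:R]natr1 (exprS _ n.+1).
  set A := (1 - p) ^+ n.+1; set y := n%:R.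
  have A0 : 0 <= A by rewrite exprn_ge0// subr_ge0.
  have y0 : 0 <= y by [].
  move=> IH.
  have F0 : 0 < 1 + y / 2 * p by have := mulr_ge0 y0 p0; lra.
  rewrite -(ler_pM2r F0).
  have h : (1 - p) * (1 + (y + 1) / 2 * p) * (1 - (y + 1 + 1) / 2 * p) <=
           (1 - p) * (1 + (y + 1) / 2 * p) * (A * (1 + y / 2 * p)).
    apply: ler_wpM2l IH; apply: mulr_ge0; first by rewrite subr_ge0.
    by have yp := mulr_ge0 y0 p0; have := p0; lra.
  apply: le_trans (le_trans _ h) _; last by rewrite le_eqVlt; apply/orP; left; apply/eqP; ring.
  rewrite -subr_ge0.
  have -> : (1 - p) * (1 + (y + 1) / 2 * p) * (1 - (y + 1 + 1) / 2 * p) -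
    (1 - (y + 1 + 1 + 1) / 2 * p) * (1 + y / 2 * p) = (y + 1) * (y + 2) / 4 * p ^+ 3.
    by field.
  by rewrite mulr_ge0 ?exprn_ge0// mulr_ge0// mulr_ge0//; lra.
have := pow M.-1; rewrite prednK 1?ltnW//.
have -> : M.-1%:R = M%:R - 1 :> R by rewrite -[in RHS](@prednK M) 1?ltnW// -natr1 addrK.
rewrite /survive; lra.
Qed.

End Survive.

Lemma hitp01 L j c : 0 <= hitp L j c <= 1.
Proof.
elim: j c => [|j IH] c /=; first by case: (L c); rewrite ?lexx ?ler01.
have /andP p01 : 0 <= avg (fun i => hitp L j (rcons c i)) <= 1.
  by rewrite avg_ge0 ?avg_le1// => i; have /andP[] := IH (rcons c i).
by rewrite survive_ge0 ?survive_le1//; apply/andP.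
Qed.

Lemma avg_hitp01 L j c : 0 <= avg (fun i => hitp L j (rcons c i)) <= 1.
Proof. by rewrite avg_ge0 ?avg_le1// => i; have /andP[] := hitp01 L j (rcons c i). Qed.

Lemma survive_le p p' : 0 <= p -> p <= p' -> p' <= 1 -> survive p <= survive p'.
Proof.
move=> p0 pp p1; rewrite lerD2l lerN2 ler_pXn2r ?nnegrE ?subr_ge0//; first by rewrite lerD2l lerN2.
  exact: ltnW.
exact: le_trans pp p1.
Qed.

Fixpoint levelsq (nu : seq Q -> R) (k : nat) (c : seq Q) : R :=
  if k is k'.+1 then \sum_i levelsq nu k' (rcons c i) else nu c ^+ 2.

(** [c] is treated as a new root: its own term has weight 1, and the levels 0 to n - 1 below it are
    counted. This is what makes [energyS] a recursion. *)
Definition energy nu n c := \sum_(k < n) brate ^+ k * levelsq nu k c.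

Lemma levelsq_ge0 nu k c : 0 <= levelsq nu k c.
Proof. by elim: k c => [|k IH] c /=; [exact: sqr_ge0|apply: sumr_ge0]. Qed.

Lemma energyS nu n c :
  energy nu n.+1 c = nu c ^+ 2 + brate * \sum_i energy nu n (rcons c i).
Proof.
rewrite /energy big_ord_recl expr0 mul1r; congr (_ + _).
rewrite exchange_big mulr_sumr; apply: eq_bigr => k _ /=.
by rewrite exprS -mulrA; congr (_ * _); rewrite mulr_sumr.
Qed.

Lemma energy_ge0 nu n c : 0 <= energy nu n c.
Proof. by apply: sumr_ge0 => k _; rewrite mulr_ge0 ?levelsq_ge0// exprn_ge0// ltW// brate_gt0. Qed.

Lemma levelsq_le nu nu' k c : (forall c, 0 <= nu c <= nu' c) ->
  levelsq nu k c <= levelsq nu' k c.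
Proof.
move=> nn; elim: k c => [|k IH] c /=; last by apply: ler_sum.
by have /andP[n0 nn'] := nn c; rewrite ler_sqr ?nnegrE// (le_trans n0 nn').
Qed.

Lemma energy_le nu nu' n c : (forall c, 0 <= nu c <= nu' c) -> energy nu n c <= energy nu' n c.
Proof.
move=> nn; apply: ler_sum => k _; rewrite ler_wpM2l ?exprn_ge0 ?(ltW brate_gt0)//.
exact: levelsq_le.
Qed.

(** The products [h i * e i] stand in for square roots. The mixed term follows from x1^2 x2^2 <= (h1
    e2)(h2 e1), which is at most the square of half the sum of the two factors. *)
Lemma cauchy_schwarz_sum (I : finType) (x h e : I -> R) :
  (forall i, 0 <= x i) -> (forall i, 0 <= h i) -> (forall i, 0 <= e i) ->
  (forall i, x i ^+ 2 <= h i * e i) ->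
  (\sum_i x i) ^+ 2 <= (\sum_i h i) * (\sum_i e i).
Proof.
move=> x0 h0 e0 xhe.
suff [//] : [/\ 0 <= \sum_i x i, 0 <= \sum_i h i, 0 <= \sum_i e i &
  (\sum_i x i) ^+ 2 <= (\sum_i h i) * (\sum_i e i)].
elim: (index_enum I) => [|i s [IHx IHh IHe IH]]; first by rewrite !big_nil mul0r expr0n.
rewrite !big_cons; split; rewrite ?addr_ge0//.
move: (x i) (h i) (e i) (x0 i) (h0 i) (e0 i) (xhe i) IHx IHh IHe IH.
move: (\sum_(j <- s) x j) (\sum_(j <- s) h j) (\sum_(j <- s) e j).
move=> x2 h2 e2 x1 h1 e1 x10 h10 e10 H1 x20 h20 e20 H2.
have cross : 2 * (x1 * x2) <= h1 * e2 + h2 * e1.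
  have h12 : 0 <= h1 * e2 by exact: mulr_ge0.
  have h21 : 0 <= h2 * e1 by exact: mulr_ge0.
  rewrite -ler_sqr ?nnegrE ?addr_ge0 ?mulr_ge0//.
  have : x1 ^+ 2 * x2 ^+ 2 <= (h1 * e1) * (h2 * e2) by rewrite ler_pM// sqr_ge0.
  have : 0 <= (h1 * e2 - h2 * e1) ^+ 2 by exact: sqr_ge0.
  nra.
by rewrite sqrrD mulrDl !mulrDr; lra.
Qed.

(** With p the average of the hitting probabilities of the children and T their total energy,
    Cauchy-Schwarz gives nu(c)^2 <= #|Q| p T. Multiplying [survive_lower] by nu(c)^2 / (M p) then
    yields nu(c)^2 <= h (nu(c)^2 + b T), and the bracket is the energy at [c]. *)
Lemma hitp_energy L nu j c : (forall c, 0 <= nu c) ->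
  (forall c, nu c = \sum_i nu (rcons c i)) ->
  (forall c', size c' = (size c + j)%N -> ~~ L c' -> nu c' = 0) ->
  nu c ^+ 2 <= hitp L j c * energy nu j.+1 c.
Proof.
move=> nu0 nuD; elim: j c => [|j IH] c LL.
  rewrite energyS [\sum_i _]big1 => [|i _]; last by rewrite /energy big_ord0.
  rewrite mulr0 addr0 /=; have := LL c; rewrite addn0; case: (L c) => [_|->//].
    by rewrite mul1r.
  by rewrite mul0r expr0n.
rewrite energyS /=; set p := avg _; have /andP[p0 p1] : 0 <= p <= 1 by exact: avg_hitp01.
set T := \sum_i energy _ _ _.
have T0 : 0 <= T by apply: sumr_ge0 => i _; exact: energy_ge0.
have cs : nu c ^+ 2 <= #|Q|%:R * p * T.
  rewrite -sum_avg nuD; apply: cauchy_schwarz_sum => i //.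
  - by case/andP: (hitp01 L j (rcons c i)).
  - exact: energy_ge0.
  - by apply: IH => c'; rewrite size_rcons addSnnS; exact: LL.
have [p00|pn0] := eqVneq p 0.
  have -> : nu c ^+ 2 = 0 by apply/eqP; rewrite eq_le sqr_ge0 andbT; move: cs; rewrite p00 mulr0 mul0r.
  by rewrite add0r mulr_ge0 ?mulr_ge0 ?(ltW brate_gt0)// survive_ge0// p0.
have Mp0 : 0 < M%:R * p by rewrite mulr_gt0// lt_def pn0.
have s0 : 0 <= survive p by rewrite survive_ge0// p0.
have low : M%:R * p <= survive p * (1 + M%:R * p) by apply: survive_lower; rewrite p0.
rewrite -(ler_pM2l Mp0).
apply: (@le_trans _ _ (survive p * (1 + M%:R * p) * nu c ^+ 2)).
  by rewrite ler_wpM2r// sqr_ge0.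
rewrite -[leLHS]mulrA [leRHS]mulrCA ler_wpM2l// mulrDl mul1r mulrDr addrC lerD2l.
suff -> : M%:R * p * (brate * T) = #|Q|%:R * p * T by [].
by rewrite /brate; field; rewrite gt_eqF.
Qed.

(** * The flow that splits in proportion to the hitting probabilities *)

Section Flow.
Variable h : seq Q -> R.
Hypothesis h01 : forall c, 0 <= h c <= 1.
Hypothesis hrec : forall c, h c = survive (avg (fun i => h (rcons c i))).
Hypothesis h_root : 0 < h [::].

Definition flow (c : seq Q) : R :=
  \prod_(k < size c) (h (take k.+1 c) / \sum_i h (rcons (take k c) i)).

Lemma flow_nil : flow [::] = 1. Proof. by rewrite /flow big_ord0. Qed.

Lemma flow_rcons c i : flow (rcons c i) = flow c * (h (rcons c i) / \sum_j h (rcons c j)).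
Proof.
rewrite /flow size_rcons big_ord_recr /=; congr (_ * _).
  apply: eq_bigr => k _ /=; congr (_ / _); first by rewrite -cats1 takel_cat.
  by apply: eq_bigr => j _; rewrite -(cats1 c i) takel_cat// ltnW.
rewrite -{1}(size_rcons c i) take_size; congr (_ / _).
by apply: eq_bigr => j _; rewrite -(cats1 c i) takel_cat// take_size.
Qed.

Lemma flow_ge0 c : 0 <= flow c.
Proof.
apply: prodr_ge0 => k _; rewrite divr_ge0 ?sumr_ge0//; first by case/andP: (h01 (take k.+1 c)).
by move=> i _; case/andP: (h01 (rcons (take k c) i)).
Qed.

Lemma flow_h0 c : h c = 0 -> flow c = 0.
Proof.
case/lastP: c => [h0|c i h0]; first by move: h_root; rewrite h0 ltxx.
by rewrite flow_rcons h0 mul0r mulr0.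
Qed.

Lemma h_sum0 c : \sum_i h (rcons c i) = 0 -> h c = 0.
Proof. by move=> s0; rewrite hrec /avg s0 mul0r /survive subr0 expr1n subrr. Qed.

(** Where all the children have [h] equal to 0, the quotients are 0 / 0 = 0. Additivity survives
    there because [hrec] gives [h c = 0], so the flow into [c] vanishes too; [h_root] excludes this
    case at the root. *)
Lemma flow_additive c : flow c = \sum_i flow (rcons c i).
Proof.
under eq_bigr do rewrite flow_rcons.
rewrite -mulr_sumr -mulr_suml; have [/h_sum0/flow_h0->|s0] := eqVneq (\sum_i h (rcons c i)) 0.
  by rewrite mul0r.
by rewrite divff// mulr1.
Qed.

(** The second-order constant of [survive_upper] divided by M, so that 1/h >= 1/(M p) + kappa. *)
Definition kappa : R := (M%:R - 1) / (2 * M%:R).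

Lemma kappa_gt0 : 0 < kappa.
Proof. by rewrite divr_gt0 ?mulr_gt0// subr_gt0 ltr1n. Qed.

(** Since flow(ci)^2 / h(ci) = flow(c)^2 h(ci) / s^2, with s the sum of [h] over the children, the
    bounds for the children add up to flow(c)^2 / s. As s = #|Q| p, the total is flow(c)^2 (kappa +
    1/(M p)), which [survive_upper] controls. The bound is free of [j], so it passes to the infinite
    tree. *)
Lemma flow_energy j c : kappa * energy flow j c <= flow c ^+ 2 / h c.
Proof.
elim: j c => [|j IH] c.
  rewrite /energy big_ord0 mulr0 divr_ge0 ?sqr_ge0//; by case/andP: (h01 c).
rewrite energyS; have [h0|hn0] := eqVneq (h c) 0.
  have f0 := flow_h0 h0; rewrite h0 invr0 mulr0 f0 expr0n add0r.
  suff -> : \sum_i energy flow j (rcons c i) = 0 by rewrite !mulr0.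
  apply: big1 => i _; apply/eqP; rewrite eq_le energy_ge0 andbT -(ler_pM2l kappa_gt0) mulr0.
  by apply: le_trans (IH _) _; rewrite flow_rcons f0 mul0r expr0n mul0r.
set s := \sum_i h (rcons c i).
have s_ge0 : 0 <= s by apply: sumr_ge0 => i _; case/andP: (h01 (rcons c i)).
have sn0 : s != 0 by apply: contra_neq hn0; exact: h_sum0.
have s0 : 0 < s by rewrite lt_def sn0.
have hc0 : 0 < h c by rewrite lt_def hn0; case/andP: (h01 c).
rewrite mulrDr [kappa * (brate * _)]mulrCA mulr_sumr.
have le1 : \sum_i kappa * energy flow j (rcons c i) <= flow c ^+ 2 / s.
  apply: le_trans (_ : \sum_i flow c ^+ 2 / s ^+ 2 * h (rcons c i) <= _).
    apply: ler_sum => i _; apply: le_trans (IH _) _; rewrite flow_rcons -/s.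
    have [->|hi0] := eqVneq (h (rcons c i)) 0; first by rewrite invr0 !mulr0.
    by rewrite le_eqVlt; apply/orP; left; apply/eqP; field; rewrite sn0 hi0.
  by rewrite -mulr_sumr -/s le_eqVlt; apply/orP; left; apply/eqP; field.
apply: le_trans (_ : kappa * flow c ^+ 2 + brate * (flow c ^+ 2 / s) <= _).
  by rewrite lerD2l ler_wpM2l// ltW// brate_gt0.
set p := avg (fun i => h (rcons c i)).
have sp : s = #|Q|%:R * p by rewrite /s sum_avg.
have p0 : 0 < p by rewrite -(pmulr_rgt0 _ m_gt0) -sp.
have p1 : p <= 1 by apply: avg_le1 => i; case/andP: (h01 (rcons c i)).
have up : survive p * (1 + (M%:R - 1) / 2 * p) <= M%:R * p by apply: survive_upper; rewrite ltW.
rewrite -hrec in up; rewrite ler_pdivlMr// /kappa /brate sp.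
have -> : ((M%:R - 1) / (2 * M%:R) * flow c ^+ 2 + #|Q|%:R / M%:R * (flow c ^+ 2 / (#|Q|%:R * p))) * h c
   = (h c * (1 + (M%:R - 1) / 2 * p)) / (M%:R * p) * flow c ^+ 2.
  by field; rewrite !gt_eqF.
by rewrite ler_piMl ?sqr_ge0// ler_pdivrMr ?mul1r// mulr_gt0.
Qed.

End Flow.

(** * Decreasing leaf sets and their limiting hitting probabilities *)

Section Limit.
Variable L : nat -> seq Q -> bool.
Hypothesis Lmono : forall n c i, size c = n -> L n.+1 (rcons c i) -> L n c.

(** [L n] speaks of words of size [n], so the leaves seen from [c] after [n] generations are those
    of [L (n + size c)]. *)
Let u c n := hitp (L (n + size c)) n c.

Lemma hitp_decr c : {homo u c : n p / (n <= p)%N >-> p <= n}.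
Proof.
apply/nonincreasing_seqP => n; rewrite /u.
elim: n c => [|n IH] c.
  rewrite add0n; have [Lc|nLc] := boolP (L (size c) c).
    by rewrite /= Lc; case/andP: (hitp01 (L (1 + size c)) 1 c).
  rewrite add1n /= /avg big1 => [|i _]; first by rewrite mul0r /survive subr0 expr1n subrr.
  by case: (boolP (L _ _)) => // /Lmono Lc; rewrite Lc in nLc.
have IHi i := IH (rcons c i).
change (survive (avg (fun i => hitp (L (n.+2 + size c)) n.+1 (rcons c i))) <=
  survive (avg (fun i => hitp (L (n.+1 + size c)) n (rcons c i)))).
apply: survive_le; [by case/andP: (avg_hitp01 (L (n.+2 + size c)) n.+1 c)| |
  by case/andP: (avg_hitp01 (L (n.+1 + size c)) n c)].
by apply: avg_le => i; have := IHi i; rewrite size_rcons !addSnnS.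
Qed.

Definition hlim c : R := limn (u c).

Lemma cvg_hlim c : u c @ \oo --> hlim c.
Proof.
apply: nonincreasing_is_cvgn; first exact: hitp_decr.
by exists 0 => _ [n _ <-]; case/andP: (hitp01 (L (n + size c)) n c).
Qed.

Lemma hlim_le n c : hlim c <= u c n.
Proof.
apply: nonincreasing_cvgn_ge; [exact: hitp_decr|apply/cvg_ex; exists (hlim c); exact: cvg_hlim].
Qed.

Lemma hlim01 c : 0 <= hlim c <= 1.
Proof.
apply/andP; split.
  apply: limr_ge; first by apply/cvg_ex; exists (hlim c); exact: cvg_hlim.
  by apply: nearW => n; case/andP: (hitp01 (L (n + size c)) n c).
by apply: le_trans (hlim_le 0 c) _; case/andP: (hitp01 (L (0 + size c)) 0 c).
Qed.

Lemma hlim_ge (r : R) : (forall n, r <= hitp (L n) n [::]) -> r <= hlim [::].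
Proof.
move=> rL; apply: limr_ge; first by apply/cvg_ex; exists (hlim [::]); exact: cvg_hlim.
by apply: nearW => n; rewrite /u addn0.
Qed.

Lemma hlim_leaf c : ~~ L (size c) c -> hlim c = 0.
Proof.
move=> nL; apply/eqP; rewrite eq_le; case/andP: (hlim01 c) => -> _; rewrite andbT.
by apply: le_trans (hlim_le 0 c) _; rewrite /u/= add0n (negbTE nL).
Qed.

(** The recursion at finite depth passes to the limit: [survive] is a polynomial and [avg] a finite
    sum. *)
Lemma hlim_rec c : hlim c = survive (avg (fun i => hlim (rcons c i))).
Proof.
have us : (fun n => u c n.+1) @ \oo --> hlim c by rewrite cvg_shiftS; exact: cvg_hlim.
apply: (cvg_unique _ us) => //.
have -> : (fun n => u c n.+1) = (fun n => survive (avg (fun i => u (rcons c i) n))).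
  apply/funext => n; rewrite /u /=; congr (survive (avg _)); apply/funext => i.
  by rewrite size_rcons addSnnS.
rewrite /survive; apply: cvgB; first exact: cvg_cst.
apply: (@continuous_cvg _ _ _ _ _ (fun n => 1 - avg (fun i => u (rcons c i) n)) (fun x : R => x ^+ M)).
  exact: exprn_continuous.
apply: cvgB; first exact: cvg_cst.
apply: cvgMl; apply: (cvg_big (op := +%R)) => [|i _]; [exact: add_continuous|exact: cvg_hlim].
Qed.

End Limit.

End TreeRecursion.

(** * Law of the tree-indexed field *)

Lemma bigcap_setT_forall (T : Type) (J : Type) (A : J -> set T) :
  \bigcap_(j in [set: J]) A j = [set x | forall j, A j x].
Proof. by apply/seteqP; split=> x h j => [|_]; exact: h. Qed.

Lemma indep_finType (R : realType) (K : fieldType) (a : K -> R) dO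
    (Omega : measurableType dO) (P : probability Omega R) (I : Type) (valid : I -> Prop)
    (Y : I -> Omega -> K) (J : finType) (f : J -> I) (A : J -> set (borelT a)) :
  mutually_independent a P valid Y -> injective f -> (forall j, valid (f j)) ->
  (forall j, measurable (A j)) ->
  P [set w | forall j, A j (Y (f j) w)] = (\prod_j P (Y (f j) @^-1` A j))%E.
Proof.
move=> ind finj vf mA.
have := ind #|J| (f \o enum_val) (inj_comp finj enum_val_inj) (fun k => vf _)
  (A \o enum_val) (fun k => mA _).
rewrite bigcap_setT_forall => h; rewrite (reindex (@enum_val J J)) /=; last first.
  exact/onW_bij/enum_val_bij.
rewrite -h; congr (P _); apply/seteqP; split=> w /= Aw j; first exact: Aw.
by have := Aw (enum_rank j); rewrite enum_rankK.
Qed.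

Section TreeField.
Variables (R : realType) (K : fieldType) (a : K -> R) (q : nat) (rho : K).
Hypothesis HK : local_field_abs a q rho.
Variable lam : {measure set (borelT a) -> \bar R}.
Hypothesis Hlam : haar q rho lam.
Variable r : 'I_q -> K.
Hypothesis Hr : residue_system a r.
Variables N d : nat.
Variables (dO : measure_display) (Omega : measurableType dO) (P : probability Omega R).
Variable Z : nat -> set 'rV[K]_N -> 'I_d -> Omega -> K.
Hypothesis HZmeas : forall n C i, is_coset a rho n C ->
  forall A : set (borelT a), measurable A -> measurable (Z n C i @^-1` A).
Hypothesis HZind : mutually_independent a P
  (fun j : nat * set 'rV[K]_N * 'I_d => is_coset a rho j.1.1 j.1.2)
  (fun j => Z j.1.1 j.1.2 j.2).
Hypothesis HZunif : forall n C i, is_coset a rho n C ->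
  forall A : set (borelT a), measurable A ->
    P (Z n C i @^-1` A) =
    (lam (A `&` rhoD a rho n) * ((fine (lam (rhoD a rho n)))^-1)%:E)%E.

Local Notation qe n := ((q%:R : R) ^- n).
Local Notation QN := (digit q N).
Local Notation Qd := (digit q d).
Local Notation pt := (pt rho r).
Local Notation cong := (cong a q).
Local Notation wcode := (wcode a rho r).

Definition ucoset (u : seq QN) := coset a rho (size u) (pt u).

Lemma ucosetP u : is_coset a rho (size u) (ucoset u).
Proof. by exists (pt u) => //; exact: (pt_Dn HK Hr). Qed.

Lemma coset_cong n (s t : 'rV[K]_N) : cong n s t <-> coset a rho n t s.
Proof.
split=> [/(cong_rho HK)[y Dy ->]|[y Dy <-]]; first by exists y.
exact: (rho_cong HK Dy).
Qed.

Lemma coset_eq n (s t : 'rV[K]_N) : cong n s t -> coset a rho n s = coset a rho n t.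
Proof.
move=> st; apply/seteqP; split=> x /coset_cong xs; apply/coset_cong.
  exact: (cong_trans HK xs st).
exact: (cong_trans HK xs (cong_sym HK st)).
Qed.

Lemma ucoset_inj u u' : size u = size u' -> ucoset u = ucoset u' -> u = u'.
Proof.
move=> su uu'; apply: (word_inj HK Hr su (erefl _)).
by apply/coset_cong; rewrite /ucoset in uu'; rewrite -uu' su; apply/coset_cong; exact: (cong_refl HK).
Qed.

Lemma coset_take n k (t : 'rV[K]_N) : Dn a N t -> (k <= n)%N ->
  coset a rho k t = ucoset (take k (wcode n t)).
Proof.
move=> Dt kn; rewrite (take_wcode HK Hr Dt kn) /ucoset (size_wcode HK Hr)//.
by apply: coset_eq; exact: (cong_wcode HK Hr).
Qed.

Definition Zv (u : seq QN) (w : Omega) : 'rV[K]_d := \row_i Z (size u) (ucoset u) i w.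

Lemma Zball k C i n x : is_coset a rho k C -> (k <= n)%N ->
  P (Z k C i @^-1` kball a q n x) = (if a x <= qe k then qe (n - k) else 0)%:E.
Proof.
move=> vC kn; rewrite HZunif//; last exact: (measurable_kball HK).
rewrite -(kball_rhoD HK) (lam_kballE HK Hlam) /=; case: ifP => ax.
  have -> : kball a q n x `&` kball a q k 0 = kball a q n x.
    apply/setIidPl => y; rewrite /kball/= subr0 => yx; rewrite -[y](subrK x).
    by apply: (a_addle HK) ax; apply: le_trans yx (qe_le HK kn).
  rewrite (lam_kballE HK Hlam) -EFinM; congr EFin.
  rewrite -{1}(subnK kn) exprD invfM mulfK// invr_eq0 expf_neq0//; exact: (qR_neq0 HK).
have -> : kball a q n x `&` kball a q k 0 = set0.
  apply/seteqP; split=> y //; rewrite /kball/= subr0 => -[yx y0].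
  move/negP: ax; apply; rewrite -[x](subrK y) (a_addle HK)// (a_subC HK).
  exact: le_trans yx (qe_le HK kn).
by rewrite measure0 mul0e.
Qed.

(** For k <= n, the probability that Z_C is congruent to [x] modulo rho^n when [C] has level [k]. *)
Definition pball k n (x : 'rV[K]_d) : R := if `[< cong k x 0 >] then (qe (n - k)) ^+ d else 0.

Lemma pball_prod k n (x : 'rV[K]_d) :
  \prod_(i < d) (if a (x ord0 i) <= qe k then qe (n - k) else 0) = pball k n x.
Proof.
rewrite /pball; case: asboolP => [x0|nx0].
  rewrite (eq_bigr (fun=> qe (n - k))) ?prodr_const ?card_ord// => i _.
  by have := x0 i; rewrite !mxE subr0 => ->.
suff [i ni] : exists i, ~ a (x ord0 i) <= qe k by rewrite (bigD1 i)//= (negbTE (introN idP ni)) mul0r.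
by apply/existsNP; apply: contra_not nx0 => x0 i; rewrite mxE subr0.
Qed.

Lemma measurable_Zball n u x : measurable [set w | cong n (Zv u w) x].
Proof.
have -> : [set w | cong n (Zv u w) x] =
    \bigcap_(i in [set: 'I_d]) (Z (size u) (ucoset u) i @^-1` kball a q n (x ord0 i)).
  by rewrite bigcap_setT_forall; apply/seteqP; split=> w h i; have := h i; rewrite /kball/= mxE.
apply: fin_bigcap_measurable => // i _; apply: HZmeas; first exact: ucosetP.
exact: (measurable_kball HK).
Qed.

Lemma prob_Zballs (J : finType) (f : J -> seq QN) n (x : J -> 'rV[K]_d) : injective f ->
  (forall j, (size (f j) <= n)%N) ->
  P [set w | forall j, cong n (Zv (f j) w) (x j)] = (\prod_j pball (size (f j)) n (x j))%:E.
Proof.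
move=> finj fn.
pose F (p : J * 'I_d) := ((size (f p.1), ucoset (f p.1)), p.2).
have Finj : injective F.
  by move=> [j i] [j' i'] [] /= sj /(ucoset_inj sj)/finj -> ->.
have := @indep_finType _ _ a _ _ P _ _ _ _ F (fun p => kball a q n (x p.1 ord0 p.2)) HZind Finj
  (fun p => ucosetP _) (fun p => measurable_kball HK n _).
have -> : [set w | forall p, kball a q n (x p.1 ord0 p.2) (Z (F p).1.1 (F p).1.2 (F p).2 w)] =
    [set w | forall j, cong n (Zv (f j) w) (x j)].
  apply/seteqP; split=> w /= h; first by move=> j i; rewrite mxE; exact: (h (j, i)).
  by move=> [j i]; have := h j i; rewrite mxE.
move=> ->; rewrite -prodEFin; under [RHS]eq_bigr do rewrite -pball_prod -prodEFin.
by rewrite pair_bigA; apply: eq_bigr => -[j i] _ /=; apply: Zball => //; exact: ucosetP.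
Qed.

Lemma prob_Zball n u x : (size u <= n)%N ->
  P [set w | cong n (Zv u w) x] = (pball (size u) n x)%:E.
Proof.
move=> un; have := @prob_Zballs unit (fun=> u) n (fun=> x).
rewrite big_const card_unit /= mulr1 => <-//; last by move=> [] [].
by congr (P _); apply/seteqP; split => w /= h; [move=> _|exact: (h tt)].
Qed.

Let d0 : QN := [ffun=> Ordinal (ltnW (q_gt1 HK))].

(** * The values of the field modulo rho^n *)

Section Depth.
Variable n : nat.

Local Notation W := (n.-tuple Qd).

(** Obtained from probabilities instead of counting words: both sides are the probability that a
    value of level [k] is congruent to [y] modulo rho^(k+1), computed at precision [n] and at
    precision [k.+1]. The word [u] is an arbitrary choice of a coset of level [k]. *)
Lemma pball_sum k y : (k < n)%N -> cong k y 0 ->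
  \sum_(z : W | `[< cong k.+1 (pt z) y >]) pball k n (pt z) = (#|{: Qd}|%:R)^-1.
Proof.
move=> kn y0; pose u := nseq k d0.
have su : size u = k by rewrite size_nseq.
have [||w|_] := @measure_finU _ _ _ P _ (fun z : W => `[< cong k.+1 (pt z) y >])
    (fun z => [set w | cong n (Zv u w) (pt z)]) [set w | cong k.+1 (Zv u w) y].
- by move=> z _; exact: measurable_Zball.
- move=> z z' w _ _ zw zw'; apply/val_inj/(word_inj HK Hr (size_tuple z) (size_tuple z')).
  exact: (cong_trans HK (cong_sym HK zw) zw').
- split=> [wy|[z /asboolP zy] wz]; last first.
    exact: (cong_trans HK (cong_le HK kn wz) zy).
  have Dw : Dn a d (Zv u w).
    apply/(cong0_Dn a q); apply: (cong_trans HK (cong_le HK (leq0n _) wy)).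
    exact: (cong_le HK (leq0n _) y0).
  exists (Tuple (introT eqP (size_wcode HK Hr n Dw))); last exact: (cong_wcode HK Hr).
  apply/asboolP; apply: (cong_trans HK _ wy); apply: (cong_sym HK).
  by apply: (cong_le HK kn); exact: (cong_wcode HK Hr).
move=> h.
have {h} : (pball k k.+1 y)%:E = (\sum_(z : W | `[< cong k.+1 (pt z) y >]) pball k n (pt z))%:E.
  rewrite -{1}su -prob_Zball ?su// [LHS]h -sumEFin.
  by apply: eq_bigr => z _; rewrite [LHS]prob_Zball su// ltnW.
move=> [<-]; rewrite /pball; case: asboolP => // _.
by rewrite subSnn expr1 card_digit natrX exprVn.
Qed.

(* The values modulo [rho ^+ n] of [Z] on a subtree of depth [j]: the one at its root, and a
   configuration for each child. *)
Fixpoint conf (j : nat) : finType :=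
  if j is j'.+1 then (W * {ffun QN -> conf j'})%type : finType else unit.

(** [None] is the root and [Some (c, v)] the node [v] in the subtree of the child [c]. With all
    nodes in one finite index type, [prob_Zballs] gives the law of a whole configuration at once. *)
Fixpoint node (j : nat) : finType :=
  if j is j'.+1 then option (QN * node j') : finType else void.

Fixpoint node_path j : node j -> seq QN :=
  if j is j'.+1 then fun v : node j'.+1 => if v is Some p then p.1 :: node_path p.2 else [::]
  else fun=> [::].

Fixpoint confval j : conf j -> node j -> W :=
  if j is j'.+1 then fun (o : conf j'.+1) (v : node j'.+1) =>
    if v is Some p then confval (o.2 p.1) p.2 else o.1
  else fun _ (v : node 0) => match v : void with end.

Fixpoint cweight j k : conf j -> R :=
  if j is j'.+1 then fun o : conf j'.+1 => pball k n (pt o.1) * \prod_c cweight k.+1 (o.2 c)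
  else fun=> 1.

Fixpoint cevent j (u : seq QN) : conf j -> set Omega :=
  if j is j'.+1 then fun o : conf j'.+1 =>
    [set w | cong n (Zv u w) (pt o.1) /\ forall c, cevent (rcons u c) (o.2 c) w]
  else fun=> setT.

Lemma node_path_inj j : injective (@node_path j).
Proof.
elim: j => [[]|j IH] [[c v]|] [[c' v']|] //= [-> /IH ->]; by [].
Qed.

Lemma size_node_path j v : (size (@node_path j v) < j)%N.
Proof. by elim: j v => [[]|j IH] [[c v]|] //=; rewrite ltnS IH. Qed.

Lemma ceventE j u (o : conf j) w :
  cevent u o w <-> forall v, cong n (Zv (u ++ node_path v) w) (pt (confval o v)).
Proof.
elim: j u o => [|j IH] u o /=; first by split=> // _ [].
split=> [[h0 h] [[c v]|]|h] /=; first by rewrite -cat_rcons; have /IH := h c.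
  by rewrite cats0.
split=> [|c]; first by have := h None; rewrite /= cats0.
by apply/IH => v; have := h (Some (c, v)); rewrite /= cat_rcons.
Qed.

Lemma cweightE j k (o : conf j) :
  cweight k o = \prod_v pball (k + size (node_path v)) n (pt (confval o v)).
Proof.
elim: j k o => [|j IH] k o; first by rewrite big_pred0.
rewrite (bigD1 None)//= addn0; congr (_ * _).
rewrite (reindex_omap Some id) /=; last by case.
rewrite [RHS](eq_bigl xpredT) => [|p]; last by rewrite eqxx.
under eq_bigr do rewrite IH.
by rewrite pair_bigA; apply: eq_bigr => -[c v] _ /=; rewrite addSnnS.
Qed.

Lemma prob_cevent (o : conf n) :
  measurable (cevent [::] o) /\ P (cevent [::] o) = (cweight 0 o)%:E.
Proof.
have E : cevent [::] o = [set w | forall v, cong n (Zv (node_path v) w) (pt (confval o v))].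
  by apply/seteqP; split=> w; [move/ceventE|move=> h; apply/ceventE].
rewrite E; split.
  by rewrite -bigcap_setT_forall; apply: fin_bigcap_measurable => // v _; exact: measurable_Zball.
rewrite prob_Zballs//; first by rewrite cweightE.
  exact: node_path_inj.
by move=> v; exact/ltnW/size_node_path.
Qed.

Lemma cevent_disj j u (o o' : conf j) w : cevent u o w -> cevent u o' w -> o = o'.
Proof.
elim: j u o o' => [|j IH] u /=; first by case=> -[].
move=> [z o] [z' o'] /= [wz wo] [wz' wo']; congr pair.
  apply/val_inj/(word_inj HK Hr (size_tuple z) (size_tuple z')).
  exact: (cong_trans HK (cong_sym HK wz) wz').
by apply/ffunP => c; exact: IH (wo c) (wo' c).
Qed.

Lemma cevent_ex j u w : (size u + j <= n)%N ->
  (forall v, (size v < n)%N -> Dn a d (Zv v w)) -> exists o : conf j, cevent u o w.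
Proof.
move=> uj Dw; elim: j u uj => [|j IH] u uj; first by exists tt.
have /choice[f fP] : forall c, exists o : conf j, cevent (rcons u c) o w.
  by move=> c; apply: IH; rewrite size_rcons addSnnS.
have Du : Dn a d (Zv u w).
  by apply: Dw; apply: leq_trans uj; rewrite addnS ltnS leq_addr.
exists (Tuple (introT eqP (size_wcode HK Hr n Du)), [ffun c => f c]) => /=; split.
  exact: (cong_wcode HK Hr).
by move=> c; rewrite ffunE.
Qed.

Variable S : set 'rV[K]_d.
Hypothesis levelS : level_set (@cong d) n S.

Fixpoint avoids j (x : 'rV[K]_d) : conf j -> bool :=
  if j is j'.+1 then fun o : conf j'.+1 => [forall c, avoids (x + pt o.1) (o.2 c)]
  else fun=> ~~ `[< S x >].

(** The probability that one coset of level [k], whose ancestors add up to [x], has no descendant in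
    [S] once [j] levels, its own included, have been added. *)
Definition psi j k x := \sum_(o : conf j) cweight k o * (avoids x o)%:R.

Lemma psi0 k x : psi 0 k x = (~~ `[< S x >])%:R.
Proof. by rewrite /psi (bigD1 tt)//= big1 ?addr0 ?mul1r// => -[]. Qed.

Lemma psiS j k x :
  psi j.+1 k x = \sum_(z : W) pball k n (pt z) * psi j k.+1 (x + pt z) ^+ #|{: QN}|.
Proof.
rewrite {1}/psi (eq_bigr (fun o : W * {ffun QN -> conf j} => pball k n (pt o.1) *
   \prod_c (cweight k.+1 (o.2 c) * (avoids (x + pt o.1) (o.2 c))%:R))); last first.
  move=> o _ /=; rewrite -mulrA big_split /=; congr (_ * (_ * _)).
  case: forallP => [h|h]; first by rewrite big1// => c _; rewrite h.
  have /existsNP[c /negP/negbTE hc] : ~ (forall c, avoids (x + pt o.1) (o.2 c)) by [].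
  by rewrite (bigD1 c)//= hc mul0r.
rewrite -(pair_bigA _ (fun (z : W) (o : {ffun QN -> conf j}) => pball k n (pt z) *
   \prod_c (cweight k.+1 (o c) * (avoids (x + pt z) (o c))%:R)))/=.
apply: eq_bigr => z _; rewrite -mulr_sumr; congr (_ * _).
by rewrite -(bigA_distr_bigA (fun (c : QN) o => cweight k.+1 o * (avoids (x + pt z) o)%:R)) prodr_const.
Qed.

Local Notation M := (#|{: QN}|).
Let L (c : seq Qd) := `[< S (pt c) >].

Let M_gt0 : (0 < M)%N.
Proof. by apply/card_gt0P; exists d0. Qed.

(** The value at level [k] moves [x] to one of the q^d sub-balls of its ball of radius q^-k, all
    equally likely; a value not congruent to 0 modulo rho^k has weight 0. The sum over [z] is
    regrouped by the sub-ball containing [x + pt z]. *)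
Lemma psiS_avg j k x : (j + k.+1 = n)%N -> Dn a d x ->
  (forall y, Dn a d y -> psi j k.+1 y ^+ M = 1 - hitp R M L j (wcode k.+1 y)) ->
  psi j.+1 k x = 1 - avg (fun i => hitp R M L j (rcons (wcode k x) i)).
Proof.
move=> jkn Dx IH; have kn : (k < n)%N by rewrite -jkn leq_addl.
rewrite psiS; set c := wcode k x.
have sc : size c = k by exact: (size_wcode HK Hr).
pose y i := pt (rcons c i) - x.
have yE i z : cong k.+1 (pt z) (y i) <-> cong k.+1 (x + pt z) (pt (rcons c i)).
  split=> h; first by have := congD HK (cong_refl HK _ x) h; rewrite /y addrCA subrr addr0.
  by have := congD HK (cong_refl HK _ (- x)) h; rewrite /y addKr addrC.
have y0 i : cong k (y i) 0.
  rewrite -(subrr x) /y; apply: (congD HK); last exact: (cong_refl HK).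
  apply: (cong_sym HK); apply: (cong_trans HK (cong_wcode HK Hr k Dx)).
  rewrite -/c; apply: (cong_sym HK); rewrite -sc.
  by have := pt_take HK Hr (n := size c) (c := rcons c i);
  rewrite size_rcons leqnSn -cats1 take_size_cat//; exact.
have Dxz z : Dn a d (x + pt z) by apply: (DnD HK) => //; exact: (pt_Dn HK Hr).
transitivity (\sum_(z : W) \sum_(i | `[< cong k.+1 (pt z) (y i) >])
    pball k n (pt z) * (1 - hitp R M L j (rcons c i))).
  apply: eq_bigr => z _; rewrite IH//.
  have [z0|nz0] := pselect (cong k (pt z) 0); last first.
    rewrite /pball; case: asboolP => // _; rewrite mul0r big1// => i _; exact: mul0r.
  have cxz : wcode k (x + pt z) = c.
    apply/(wcode_cong HK Hr) => //; have := congD HK (cong_refl HK k x) z0; by rewrite addr0.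
  have [i iE] := wcode_rcons HK Hr k (Dxz z); rewrite cxz in iE.
  rewrite iE (big_pred1 i) // => i' /=; apply/asboolP/eqP => [/yE h|->]; last first.
    by apply/yE; rewrite -iE; exact: (cong_wcode HK Hr).
  have := wcode_uniq HK Hr (c := rcons c i') _ h; rewrite size_rcons sc iE => /(_ erefl).
  by move/rcons_inj => -[].
under eq_bigr do rewrite big_mkcond /=.
rewrite exchange_big /=.
transitivity (\sum_i (#|{: Qd}|%:R)^-1 * (1 - hitp R M L j (rcons c i))).
  apply: eq_bigr => i _; rewrite -(pball_sum kn (y0 i)) mulr_suml [RHS]big_mkcond /=.
  by apply: eq_bigr => z _; case: ifP.
have cd : #|{: Qd}|%:R != 0 :> R.
  by rewrite pnatr_eq0 card_digit expn_eq0 negb_and -lt0n (ltnW (q_gt1 HK)).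
rewrite -mulr_sumr sumrB sumr_const mulrBr mulVf//; congr (_ - _).
by rewrite /avg mulrC.
Qed.

(** The power stands for the M cosets of level [k] below a common parent sitting in the ball
    [wcode k x]: [hitp] starts from a ball with M children, [psi] from a single child. *)
Lemma psi_hitp j k x : (j + k = n)%N -> Dn a d x ->
  psi j k x ^+ M = 1 - hitp R M L j (wcode k x).
Proof.
elim: j k x => [|j IH] k x jkn Dx.
  rewrite psi0 /= /L; have -> : `[< S (pt (wcode k x)) >] = `[< S x >].
    apply/asbool_equiv_eq; rewrite add0n in jkn; rewrite jkn.
    have h := cong_wcode HK Hr n Dx; split; apply: levelS => //; exact: (cong_sym HK).
  by case: asboolP => _ /=; rewrite ?expr1n ?expr0n ?(gtn_eqF M_gt0) ?subr0 ?subrr.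
rewrite (psiS_avg (k := k)) => //; last first.
- by move=> y Dy; apply: IH; rewrite // addnS -addSn.
- by rewrite addnS -addSn.
by rewrite /= /survive opprB addrCA subrr addr0.
Qed.

(** The sum stops before [v] itself: when the values have their expected size, those of level
    [size v] and beyond are 0 modulo rho^(size v). *)
Definition psum (v : seq QN) w : 'rV[K]_d := \sum_(k < size v) Zv (take k v) w.

Lemma avoidsP j u (o : conf j) w x y : cevent u o w -> cong n x y ->
  avoids x o <-> forall v, size v = j -> ~ S (y + \sum_(k < j) Zv (u ++ take k v) w).
Proof.
elim: j u o x y => [|j IH] u o x y /=.
  move=> _ xy; split=> [/asboolPn nSx v _|h].
    rewrite big_ord0 addr0 => Sy; apply: nSx; apply: levelS Sy; exact: (cong_sym HK).
  by apply/asboolPn => /(levelS xy); have := h [::] erefl; rewrite big_ord0 addr0.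
move=> [wz wo] xy.
have xyc := congD HK xy (cong_sym HK wz).
have Sm c v : y + Zv u w + \sum_(k < j) Zv (rcons u c ++ take k v) w =
    y + \sum_(k < j.+1) Zv (u ++ take k (c :: v)) w.
  rewrite big_ord_recl /= cats0 addrA; congr (_ + _).
  by apply: eq_bigr => k _; rewrite cat_rcons.
split=> [/forallP h [|c v]// [sv]|h].
  by rewrite -Sm; have /(IH _ _ _ _ (wo c) xyc) := h c; exact.
apply/forallP => c; apply/(IH _ _ _ _ (wo c) xyc) => v sv.
by rewrite Sm; apply: h; rewrite /= sv.
Qed.

(** Level 0 has one coset, so no power M appears and the average is not inside [survive].
    Integrality of the values belongs to the event because a configuration records only integral
    ones. *)
Lemma prob_miss : (0 < n)%N ->
  let E := [set w | (forall v, (size v < n)%N -> Dn a d (Zv v w)) /\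
                    forall v, size v = n -> ~ S (psum v w)] in
  measurable E /\ P E = (1 - avg (fun i => hitp R M L n.-1 [:: i]))%:E.
Proof.
move=> n0 E.
have E0 : E = [set w | exists2 o : conf n, avoids 0 o & cevent [::] o w].
  apply/seteqP; split=> w /=.
    move=> [Dw h].
    have [oo oP] := cevent_ex (u := [::]) (leqnn n) Dw.
    exists oo => //; apply/(avoidsP oP (cong_refl HK n 0)) => v sv; rewrite add0r.
    by have := h v sv; rewrite /psum sv.
  move=> [cf oa oP]; split=> [v sv|v sv].
    have [v' ->] : exists v' : node n, v = node_path v'.
      elim: (n) v sv {cf oa oP} => [//|j IH] [|c v] sv; first by exists None.
      by have [v' ->] := IH v sv; exists (Some (c, v')).
    have /ceventE/(_ v') := oP; rewrite /= => h.
    exact: (cong_Dn HK (cong_sym HK h) (pt_Dn HK Hr _)).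
  have /(avoidsP oP (cong_refl HK n 0))/(_ v sv) := oa.
  by rewrite add0r /psum sv.
have [||w|mE ->] := @measure_finU _ _ _ P _ (fun o : conf n => avoids 0 o)
    (fun o => cevent [::] o) E.
- by move=> o _; case: (prob_cevent o).
- by move=> o o' w _ _; exact: cevent_disj.
- by rewrite E0.
split=> //.
have -> : (\sum_(o : conf n | avoids 0 o) P (cevent [::] o))%E = (psi n 0 0)%:E.
  rewrite /psi -sumEFin big_mkcond /=; apply: eq_bigr => o _; case: ifP => _; last by rewrite mulr0.
  by rewrite mulr1; case: (prob_cevent o).
congr EFin; have nE := prednK n0.
have D0 : Dn a d (0 : 'rV[K]_d) by apply/(cong0_Dn a q); exact: (cong_refl HK).
have := @psiS_avg n.-1 0 0; rewrite addn1 nE => -> //.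
  by have /size0nil -> := size_wcode HK Hr 0 D0.
by move=> y Dy; apply: psi_hitp; rewrite // addn1.
Qed.

End Depth.

End TreeField.

(** * The energy integral *)

Section Energy.
Variables (R : realType) (K : fieldType) (a : K -> R) (q : nat) (rho : K).
Hypothesis HK : local_field_abs a q rho.
Variable r : 'I_q -> K.
Hypothesis Hr : residue_system a r.
Variables N d : nat.
Hypothesis N_gt0 : (0 < N)%N.

Local Notation qe n := ((q%:R : R) ^- n).
Local Notation Qd := (digit q d).
Local Notation pt := (pt rho r).
Local Notation cong := (cong a q).
Local Notation wcode := (wcode a rho r).
Local Notation T := (borelT (@vnorm R K a d)).
Local Notation D := (Dn a d : set T).
Local Notation b := (brate R Qd (q ^ N)).

Definition ucst : R := (1 - (q%:R : R) ^- N) / (q%:R : R) ^+ d.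

Lemma ucst_gt0 : 0 < ucst.
Proof.
rewrite divr_gt0 ?exprn_gt0 ?(qR_gt0 HK)// subr_gt0 invf_lt1 ?exprn_gt0 ?(qR_gt0 HK)//.
by rewrite exprn_egt1 ?(qR_gt1 HK)// -lt0n.
Qed.

Lemma brateE : b = (q%:R : R) ^ (d%:Z - N%:Z).
Proof.
by rewrite /brate card_digit !natrX expfzDr ?(qR_neq0 HK)// -exprnN -exprnP.
Qed.

Lemma b_gt0 : 0 < b. Proof. by rewrite brateE exprz_gt0// (qR_gt0 HK). Qed.

Lemma b_lt1 : (b < 1) = (d < N)%N.
Proof. by rewrite brateE -(expr0z q%:R) ltr_eXz2l ?(qR_gt1 HK)// subr_lt0 ltz_nat. Qed.

Lemma b_eq1 : (b == 1) = (N == d).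
Proof.
have inj : injective (fun n : int => (q%:R : R) ^ n).
  by apply: ieexprIz; [exact: (qR_gt0 HK)|rewrite gt_eqF// (qR_gt1 HK)].
rewrite brateE -(expr0z q%:R) (inj_eq inj).
by rewrite subr_eq0 eqz_nat eq_sym.
Qed.

Definition uterm k (x y : 'rV[K]_d) : R := ucst * b ^+ k * (`[< cong k.+1 x y >])%:R.

Lemma uterm_ge0 k x y : 0 <= uterm k x y.
Proof. by rewrite mulr_ge0 ?ler0n// mulr_ge0 ?exprn_ge0 ?(ltW b_gt0) ?(ltW ucst_gt0). Qed.

Lemma vnorm_exact (x y : 'rV[K]_d) : Dn a d x -> Dn a d y -> x <> y ->
  exists2 j, vnorm a (x - y) = qe j & forall k, cong k x y <-> (k <= j)%N.
Proof.
move=> Dx Dy xy.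
have c0 : cong 0 x y.
  by apply: (cong_trans HK (iffLR (cong0_Dn a q x) Dx)); apply: (cong_sym HK); exact/cong0_Dn.
have [n nc] : exists n, ~ cong n x y.
  apply: contrapT => /forallNP h; apply: xy; apply/rowP => i; apply/subr0_eq.
  apply/(a_eq0 HK)/eqP; rewrite eq_le (a_ge0 HK) andbT leNgt; apply/negP => /(qe_lt_eps HK)[n].
  by have /contrapT/(_ i) := h n; rewrite leNgt => /negP.
have nex : exists n, `[< ~ cong n x y >] by exists n; exact/asboolP.
case: (ex_minnP nex) => -[|j] /asboolP ncj jmin; first by [].
have cj : cong j x y.
  by apply: contrapT => ncj'; have := jmin j (introT (asboolP _) ncj'); rewrite ltnn.
exists j; last first.
  move=> k; split=> [ck|kj]; last exact: (cong_le HK kj cj).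
  by rewrite leqNgt; apply/negP => jk; exact/ncj/(cong_le HK jk).
apply/eqP; rewrite eq_le; apply/andP; split; first exact/(cong_vnorm HK).
have [i ni] : exists i, ~ a (x ord0 i - y ord0 i) <= qe j.+1 by exact/existsNP.
have : qe j <= a ((x - y) ord0 i).
  by rewrite leNgt !mxE; apply: contra_notN ni; exact: (a_lt1 HK).
move/le_trans; apply; have := iffLR (vnorm_le a (x - y) (r := vnorm a (x - y)) _) (lexx _) i.
by apply; apply: bigmax_ge_id.
Qed.

(** If |x - y| = q^-j, the terms are [ucst * b ^+ k] for k < j and 0 afterwards, and the cases of
    [ufun] are those of a geometric sum with b = 1 or b <> 1. For x = y the whole series converges
    or diverges according to [b_lt1]. *)
Lemma ufun_series (x y : 'rV[K]_d) : Dn a d x -> Dn a d y ->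
  ufun q N d (vnorm a (x - y)) = (\sum_(0 <= k <oo) (uterm k x y)%:E)%E.
Proof.
move=> Dx Dy; have [->|/eqP xy] := eqVneq x y.
  have -> : vnorm a (y - y) = 0.
    apply/eqP; rewrite eq_le bigmax_ge_id andbT; apply/vnorm_le => // i.
    by rewrite !mxE subrr (a0 HK).
  have uE k : (uterm k y y)%:E = (ucst * b ^+ k)%:E.
    by rewrite /uterm asboolT ?mulr1//; exact: (cong_refl HK).
  rewrite /ufun eqxx -b_lt1 -/ucst -brateE (eq_eseriesr (fun k _ => uE k)); case: ltP => b1.
    apply/esym; apply: cvg_lim => //.
    have -> : (fun n => (\sum_(0 <= k < n) (ucst * b ^+ k)%:E)%E) =
        EFin \o series (geometric ucst b).
      by apply/funext => n; rewrite /series /= -sumEFin.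
    apply: cvg_EFin; first exact: nearW.
    by apply: cvg_geometric_series; rewrite gtr0_norm ?b_gt0.
  apply/esym/eqP; rewrite eq_le leey /= leNgt; apply/negP => fin.
  have c0 := ucst_gt0.
  set s := (\sum_(0 <= k <oo) _)%E in fin.
  have s0 n : ((ucst * n%:R)%:E <= s)%E.
    apply: le_trans (nneseries_lim_ge n _); last first.
      by move=> i _ _; rewrite lee_fin mulr_ge0 ?exprn_ge0 ?(ltW c0) ?(ltW b_gt0).
    rewrite sumEFin lee_fin mulrC -[n in leLHS]subn0 mulr_natl -sumr_const_nat.
    by apply: ler_sum => i _; rewrite ler_peMr ?(ltW c0)// exprn_ege1.
  have sfin : s \is a fin_num.
    by rewrite ge0_fin_numE//; apply: le_trans (s0 0); rewrite mulr0.
  have := s0 (Num.bound (fine s / ucst)); rewrite -(fineK sfin) lee_fin leNgt => /negP; apply.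
  rewrite mulrC -ltr_pdivrMr//; apply: archi_boundP; rewrite divr_ge0 ?(ltW c0)//.
  by apply: fine_ge0; apply: le_trans (s0 0); rewrite mulr0.
have [j vj cj] := vnorm_exact Dx Dy xy.
rewrite (nneseries_split 0 j); last by move=> k _; rewrite lee_fin uterm_ge0.
rewrite add0n eseries0 ?adde0 => [|k jk _]; last first.
  by rewrite /uterm asboolF ?mulr0// => /cj; rewrite ltnNge jk.
have q0 := qR_gt0 HK.
rewrite sumEFin vj /ufun (gt_eqF (qe_gt0 HK j)) -/ucst -brateE.
have -> : \sum_(0 <= k < j) uterm k x y = ucst * \sum_(k < j) b ^+ k.
  rewrite big_mkord mulr_sumr; apply: eq_bigr => k _.
  by rewrite /uterm asboolT ?mulr1//; apply/cj.
rewrite -b_eq1; case: eqP => [b1|/eqP b1]; congr EFin.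
  rewrite b1; under eq_bigr do rewrite expr1n.
  rewrite sumr_const card_ord invrK lnXn// -[ln q%:R *+ j]mulr_natl mulfK//.
  by rewrite gt_eqF// ln_gt0// (qR_gt1 HK).
have b10 : b - 1 != 0 by rewrite subr_eq0.
have -> : (qe j) ^ (N%:Z - d%:Z) = b ^+ j.
  by rewrite brateE !exprnP exprnN !exprz_exp; congr (_ ^ _); rewrite mulNr -mulrN opprB mulrC.
by rewrite subrX1 mulrA divfK.
Qed.

(** * Integrals against a finite measure carried by D^d *)

Section WithMeasure.
Variable mu : {measure set T -> \bar R}.
Hypothesis mu_fin : (mu setT < +oo)%E.
Hypothesis mu_D : mu (~` D) = 0%E.

Definition cyl (c : seq Qd) : set T := [set x | cong (size c) x (pt c)].
Definition mass (c : seq Qd) : R := fine (mu (cyl c)).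

Lemma measurable_cyl c : measurable (cyl c).
Proof. by apply: (measurable_level HK (n := size c)); exact: (level_ball HK). Qed.

Lemma measurable_D : measurable D.
Proof. by apply: (measurable_level HK (n := 0)); exact: (level_Dn HK). Qed.

Lemma mu_fin_num A : measurable A -> mu A \is a fin_num.
Proof.
move=> mA; rewrite ge0_fin_numE//; apply: le_lt_trans mu_fin.
by apply: le_measure; rewrite ?inE.
Qed.

Lemma massE c : mu (cyl c) = (mass c)%:E.
Proof. by rewrite /mass fineK// mu_fin_num//; exact: measurable_cyl. Qed.

Lemma mass_ge0 c : 0 <= mass c. Proof. exact: fine_ge0. Qed.

Lemma cyl_nil : cyl [::] = D.
Proof. by apply/seteqP; split=> x /= h; exact/(cong0_Dn a q). Qed.

Lemma cyl_Dn c : cyl c `<=` D.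
Proof. by move=> x /(cong_sym HK) h; exact: (cong_Dn HK h (pt_Dn HK Hr c)). Qed.

Lemma cyl_wcode c x : cyl c x <-> Dn a d x /\ wcode (size c) x = c.
Proof.
split=> [cx|[Dx <-]]; first by split; [exact: cyl_Dn cx|exact: (wcode_uniq HK Hr)].
by rewrite /cyl/= (size_wcode HK Hr)//; exact: (cong_wcode HK Hr).
Qed.

Lemma cyl_rcons c x : cyl c x <-> exists2 i, true & cyl (rcons c i) x.
Proof.
split=> [/cyl_wcode[Dx <-]|[i _ /cyl_wcode[Dx]]].
  have sc : size (wcode (size c) x) = size c by exact: (size_wcode HK Hr).
  have [i iE] := wcode_rcons HK Hr (size c) Dx; exists i => //; apply/cyl_wcode.
  by rewrite size_rcons sc iE.
rewrite size_rcons => e; apply/cyl_wcode; split => //.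
by rewrite -(take_wcode HK Hr Dx (leqnSn _)) e -cats1 take_size_cat.
Qed.

Lemma cyl_rcons_disj c i j x : cyl (rcons c i) x -> cyl (rcons c j) x -> i = j.
Proof.
move=> /cyl_wcode[_ h] /cyl_wcode[_]; rewrite !size_rcons in h *; rewrite h.
by move=> /rcons_inj[].
Qed.

(** |x - y| is locally constant in [y] away from [x], so every preimage is open up to the point [x],
    whatever [G] is. This covers a [G] defined by an integral, whose measurability would otherwise
    have to be proved. *)
Lemma measurable_norm (G : R -> \bar R) (x : 'rV[K]_d) :
  measurable_fun (setT : set T) ((fun y => G (vnorm a (x - (y : 'rV[K]_d)))) : T -> \bar R).
Proof.
move=> _ A _; rewrite setTI.
have m_open (U : set T) : cong_open (@cong d) U -> measurable U.
  by move=> oU; apply: sub_sigma_algebra; exact: (cong_open_open HK).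
have o1 : cong_open (@cong d) [set y | y <> x].
  move=> y yx; apply: contrapT => /forallNP h; apply: yx; apply/rowP => i; apply/subr0_eq.
  apply/(a_eq0 HK)/eqP; rewrite eq_le (a_ge0 HK) andbT leNgt; apply/negP => /(qe_lt_eps HK)[n].
  have [z [yz /contrapT zx]] : exists z, cong n y z /\ ~ (z <> x).
    by apply: contrapT => /forallNP h'; apply: (h n) => z yz zx; apply: (h' z); split=> // zx'.
  by rewrite ltNge -zx (yz i).
have ms1 : measurable ([set x] : set T).
  rewrite -[X in measurable X]setCK; apply: measurableC.
  rewrite [X in measurable X](_ : _ = [set y | y <> x]).
    exact: m_open.
  by apply/seteqP; split.
pose U : set T := [set y | y <> x /\ A (G (vnorm a (x - (y : 'rV[K]_d))))].
have mU : measurable U.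
  apply: m_open => y [yx Ay]; have [n nP] := o1 y yx.
  have [i ni] : exists i, ~ a (y ord0 i - x ord0 i) <= qe n.
    by apply/existsNP => h; apply: (nP x).
  exists n => z yz; split; first exact: nP.
  suff <- : vnorm a (x - y) = vnorm a (x - z) by [].
  (* A perturbation smaller than |u| cannot decrease the norm; used in both directions, this gives
     equality. *)
  have ultra (u v : 'rV[K]_d) : vnorm a (u - v) <= qe n -> qe n < vnorm a u -> vnorm a u <= vnorm a v.
    move=> uv nu; rewrite leNgt; apply/negP => vu.
    suff : vnorm a u < vnorm a u by rewrite ltxx.
    have u0 := lt_trans (qe_gt0 HK n) nu.
    apply/(vnorm_lt a _ u0) => k.
    apply: le_lt_trans (_ : Num.max (a ((u - v) ord0 k)) (a (v ord0 k)) < _).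
      by rewrite -{1}[u](subrK v) mxE; exact: (a_ultra HK).
    rewrite gt_max; apply/andP; split; last exact: (iffLR (vnorm_lt a _ u0) vu k).
    by apply: le_lt_trans nu; exact: (iffLR (vnorm_le a _ (qe_ge0 HK n)) uv k).
  have nxy : qe n < vnorm a (x - y).
    rewrite ltNge; apply/negP => /(cong_vnorm HK)/(cong_sym HK)/(_ i); exact: ni.
  have xyz : vnorm a (x - y - (x - z)) <= qe n.
    rewrite opprB addrC addrA subrK; apply/(vnorm_le a _ (qe_ge0 HK n)) => k.
    by have := yz k; rewrite !mxE (a_subC HK).
  have h1 := ultra _ _ xyz nxy.
  have zyx : vnorm a (x - z - (x - y)) <= qe n.
    rewrite opprB addrC addrA subrK; apply/(vnorm_le a _ (qe_ge0 HK n)) => k.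
    by have := yz k; rewrite !mxE.
  by apply/eqP; rewrite eq_le h1 (ultra _ _ zyx)//; exact: lt_le_trans h1.
have -> : (fun y : T => G (vnorm a (x - (y : 'rV[K]_d)))) @^-1` A =
    U `|` (if pselect (A (G (vnorm a (x - x)))) then [set x] else set0).
  apply/seteqP; split=> y /=.
    move=> Ay; have [yx|nyx] := pselect (y = x); last by left.
    by right; subst y; case: pselect.
  by case=> [[]//|]; case: pselect => //= h ->.
by apply: measurableU; [exact: mU|case: pselect => ?; [exact: ms1|exact: measurable0]].
Qed.

Lemma integral_D (F : T -> \bar R) : measurable_fun setT F ->
  (\int[mu]_x F x = \int[mu]_(x in D) F x)%E.
Proof.
move=> mF; rewrite [RHS]integral_mkcond; apply: ae_eq_integral => //.
  by apply: (iffLR (measurable_restrictT F measurable_D)); exact: measurable_funS mF.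
exists (~` D); split => //; first exact: measurableC measurable_D.
by move=> x /= h Dx; apply: h => _; rewrite patchE mem_set.
Qed.

Lemma integral_uterm k x : Dn a d x ->
  (\int[mu]_(y in D) (uterm k x y)%:E = (ucst * b ^+ k * mass (wcode k.+1 x))%:E)%E.
Proof.
move=> Dx; have w0 : 0 <= ucst * b ^+ k by rewrite mulr_ge0 ?exprn_ge0 ?(ltW b_gt0) ?(ltW ucst_gt0).
have E y : (uterm k x y)%:E = ((ucst * b ^+ k)%:E * (\1_(cyl (wcode k.+1 x)) y)%:E)%E.
  rewrite -EFinM /uterm indicE; congr (_ * _%:R)%:E; congr nat_of_bool.
  have c : cyl (wcode k.+1 x) y <-> cong k.+1 x y.
    rewrite /cyl/= (size_wcode HK Hr)//; have h := cong_wcode HK Hr k.+1 Dx; split=> h'.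
      exact: (cong_trans HK h (cong_sym HK h')).
    exact: (cong_trans HK (cong_sym HK h') h).
  by apply/asboolP/idP; rewrite inE; move/c.
under eq_integral do rewrite E.
rewrite ge0_integralZl_EFin//; first last.
- apply/measurable_EFinP; exact: measurable_indic (measurable_cyl _).
- exact: measurable_D.
rewrite integral_indic; [|exact: measurable_D|exact: measurable_cyl].
by rewrite (setIidl (@cyl_Dn _)) massE.
Qed.

Lemma measurable_wcode k (G : seq Qd -> R) : measurable_fun D (fun x : T => (G (wcode k x))%:E).
Proof.
move=> mD A mA; apply: (measurable_level HK (n := k)) => x y xy [Dx Ax].
have Dy := cong_Dn HK xy Dx; split=> //=.
by rewrite -(iffRL (wcode_cong HK Hr k Dx Dy) xy).
Qed.

(** On each ball [k] levels below [c] the integrand is the mass of that ball, so every ball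
    contributes the square of its mass. *)
Lemma integral_mass_cyl k c :
  (\int[mu]_(x in cyl c) (mass (wcode (size c + k) x))%:E = (levelsq mass k c)%:E)%E.
Proof.
elim: k c => [|k IH] c /=.
  rewrite addn0 (eq_integral (cst (mass c)%:E)); last first.
    by move=> x; rewrite inE => /cyl_wcode[_ ->].
  by rewrite integral_cst ?massE; [rewrite -EFinM expr2|exact: measurable_cyl].
have -> : cyl c = \big[setU/set0]_(i <- enum Qd) cyl (rcons c i).
  rewrite -bigcup_seq; apply/seteqP; split=> x.
    by move/cyl_rcons => [i _ h]; exists i => //=; rewrite mem_enum.
  by move=> [i _ h]; apply/cyl_rcons; exists i.
rewrite ge0_integral_bigsetU//=.
- rewrite big_enum /= -sumEFin; apply: eq_bigr => i _; rewrite -IH.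
  by rewrite size_rcons addSnnS.
- by move=> i; exact: measurable_cyl.
- exact: enum_uniq.
- by move=> i j _ _ [x [xi xj]]; exact: cyl_rcons_disj xi xj.
- apply: measurable_funS (measurable_wcode _ _); first exact: measurable_D.
  by rewrite -bigcup_seq => x [i _]; exact: cyl_Dn.
- by move=> x _; rewrite lee_fin mass_ge0.
Qed.

Lemma integral_energy :
  (\int[mu]_x \int[mu]_y ufun q N d (vnorm a ((x : 'rV[K]_d) - (y : 'rV[K]_d))) =
   \sum_(0 <= k <oo) (ucst * b ^+ k * levelsq mass k.+1 [::])%:E)%E.
Proof.
pose f (x : T) : \bar R := (\int[mu]_y ufun q N d (vnorm a ((x : 'rV[K]_d) - (y : 'rV[K]_d))))%E.
pose g (x : T) : \bar R := (\sum_(0 <= k <oo) (ucst * b ^+ k * mass (wcode k.+1 x))%:E)%E.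
have w0 k : 0 <= ucst * b ^+ k by rewrite mulr_ge0 ?exprn_ge0 ?(ltW b_gt0) ?(ltW ucst_gt0).
have wm0 k x : (0 <= (ucst * b ^+ k * mass (wcode k.+1 x))%:E)%E.
  by rewrite lee_fin mulr_ge0// mass_ge0.
have mw k : measurable_fun D (fun x : T => (ucst * b ^+ k * mass (wcode k.+1 x))%:E).
  exact: (measurable_wcode k.+1 (fun c => ucst * b ^+ k * mass c)).
have fg x : D x -> f x = g x.
  move=> Dx; rewrite /f integral_D; last exact: measurable_norm.
  rewrite (eq_integral (fun y : T => \sum_(0 <= k <oo) (uterm k x y)%:E)%E); last first.
    by move=> y; rewrite inE => Dy; exact: ufun_series.
  rewrite integral_nneseries; first last.
  - by move=> k y _; rewrite lee_fin uterm_ge0.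
  - move=> k mD A mA; apply: (measurable_level HK (n := k.+1)) => y z yz [Dy Ay].
    split; first exact: (cong_Dn HK yz Dy).
    rewrite /= /uterm -(_ : `[< cong k.+1 x y >] = `[< cong k.+1 x z >])//.
    apply/asbool_equiv_eq; split=> h; first exact: (cong_trans HK h yz).
    exact: (cong_trans HK h (cong_sym HK yz)).
  - exact: measurable_D.
  by apply: eq_eseriesr => k _; exact: integral_uterm.
(* The outer integral runs over the whole space, so [f] has to be measurable outside D too. There |x
   - y| = |x| for every [y] in D, and [f x] depends on |x| alone. *)
have fC x : ~ D x -> f x = (\int[mu]_y ufun q N d (vnorm a (0 - (x : 'rV[K]_d))))%E.
  move=> nDx; rewrite /f integral_D; last exact: measurable_norm.
  rewrite [RHS]integral_D; last exact: measurable_cst.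
  apply: eq_integral => y; rewrite inE => Dy; congr (ufun _ _ _ _).
  have vN (z : 'rV[K]_d) : vnorm a (- z) = vnorm a z.
    by rewrite /vnorm; apply: eq_bigr => i _; rewrite mxE (aN HK).
  rewrite sub0r vN; have y1 : vnorm a y <= 1 by apply/vnorm_le.
  have x1 : 1 < vnorm a (x : 'rV[K]_d).
    by rewrite ltNge; apply/negP => /(vnorm_le a _ ler01).
  have sub1 (u v : 'rV[K]_d) : 1 < vnorm a u -> vnorm a v <= 1 -> vnorm a (u - v) <= vnorm a u.
    move=> u1 v1; have u0 : 0 <= vnorm a u by apply: ltW; apply: lt_trans u1.
    apply/(vnorm_le a _ u0) => i; rewrite !mxE; apply: (a_addle HK).
      exact: (iffLR (vnorm_le a _ u0) (lexx _) i).
    by rewrite (aN HK); apply: le_trans (ltW u1); exact: (iffLR (vnorm_le a _ ler01) v1 i).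
  apply/eqP; rewrite eq_le sub1//=.
  have xy1 : 1 < vnorm a ((x : 'rV[K]_d) - (y : 'rV[K]_d)).
    rewrite ltNge; apply/negP => /(vnorm_le a _ ler01) h; apply: nDx => i.
    by rewrite -[x ord0 i](subrK (y ord0 i)); apply: (a_addle HK) => //; have := h i; rewrite !mxE.
  have := sub1 _ (- (y : 'rV[K]_d)) xy1; rewrite vN opprK subrK; exact.
have mf : measurable_fun setT f.
  move=> _ A mA; rewrite setTI.
  have -> : f @^-1` A = (D `&` g @^-1` A) `|` (~` D `&`
      (fun x : T => \int[mu]_y ufun q N d (vnorm a (0 - (x : 'rV[K]_d))))%E @^-1` A).
    apply/seteqP; split=> x /=.
      by move=> Ax; have [Dx|nDx] := pselect (D x); [left; rewrite -fg|right; rewrite -fC].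
    by move=> [[Dx]|[nDx]]; [rewrite -fg|rewrite -fC].
  apply: measurableU.
    have : measurable_fun D g by apply: ge0_emeasurable_sum => // k x _ _; exact: wm0.
    by apply=> //; exact: measurable_D.
  apply: measurableI; first exact: measurableC measurable_D.
  have := measurable_norm (fun r => \int[mu]_y ufun q N d r)%E 0.
  by rewrite -[X in measurable X]setTI; apply.
rewrite -/f integral_D// (eq_integral g) => [|x]; last by rewrite inE; exact: fg.
rewrite integral_nneseries//; [|exact: measurable_D]; apply: eq_eseriesr => k _.
under eq_integral do rewrite EFinM.
rewrite ge0_integralZl_EFin//; first last.
- exact: measurable_wcode.
- by move=> x _; rewrite lee_fin mass_ge0.
- exact: measurable_D.
by rewrite -cyl_nil [X in (_ * X)%E](integral_mass_cyl k.+1 [::]) -EFinM.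
Qed.

End WithMeasure.
End Energy.

(** * Covers, and the measure of a flow *)

Section OuterCover.
Variables (dO : measure_display) (Omega : measurableType dO) (R : realType).
Variable mu : {measure set Omega -> \bar R}.

Definition covered (c : R) (A : set Omega) :=
  exists M, [/\ measurable M, A `<=` M & (mu M <= c%:E)%E].

(** The covers [M n] may fail to increase. Intersecting each with all the later ones gives sets
    [F n] that increase, still contain [A n] and have measure at most [c]. *)
Lemma covered_bigcup c (A : nat -> set Omega) :
  (forall n, A n `<=` A n.+1) -> (forall n, covered c (A n)) -> covered c (\bigcup_n A n).
Proof.
move=> Ainc /choice[M MP].
have Ale m n : (m <= n)%N -> A m `<=` A n.
  by move=> /subnK <-; elim: (n - m)%N => // k IH x /IH; exact: Ainc.
pose F n := \bigcap_(k in [set k | (n <= k)%N]) M k.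
have mF n : measurable (F n) by apply: bigcap_measurable => [|k _]; [exists n => /=|case: (MP k)].
have mUF : measurable (\bigcup_n F n) by exact: bigcup_measurable.
exists (\bigcup_n F n); split=> //.
  by move=> x [n _ Ax]; exists n => // k /= nk; case: (MP k) => _ + _; apply; exact: Ale Ax.
have FF : nondecreasing_seq F.
  move=> m n mn; apply/subsetPset => x Fx k /= nk; apply: Fx => /=; exact: leq_trans nk.
have cv := nondecreasing_cvg_mu (mu := mu) mF mUF FF.
rewrite -(cvg_lim _ cv)//; apply: lime_le; first by apply/cvg_ex; exists (mu (\bigcup_n F n)).
apply: nearW => n /=; have [mM _ Mc] := MP n; apply: le_trans Mc.
by apply: le_measure; rewrite ?inE//; move=> x; apply=> /=.
Qed.

Lemma not_negligible_covered (A : set Omega) : ~ mu.-negligible A ->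
  exists2 c, 0 < c & ~ covered c A.
Proof.
move=> nA; apply: contrapT => h; apply: nA.
have /choice[M MP] : forall n : nat, covered n.+1%:R^-1 A.
  by move=> n; apply: contrapT => nc; apply: h; exists n.+1%:R^-1.
have mM : measurable (\bigcap_n M n) by apply: bigcapT_measurable => n; case: (MP n).
exists (\bigcap_n M n); split=> //; last by move=> x Ax n _; case: (MP n) => _ + _; apply.
apply/eqP; rewrite eq_le measure_ge0 andbT; apply/lee_addgt0Pr => e e0; rewrite add0e.
have [n ne] : exists n : nat, n.+1%:R^-1 < e.
  exists (Num.bound e^-1); rewrite -[e in ltRHS]invrK ltf_pV2 ?posrE ?invr_gt0//.
  apply: lt_trans (_ : (Num.bound e^-1)%:R < _); last by rewrite ltr_nat.
  by apply: archi_boundP; rewrite invr_ge0 ltW.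
have [mMn _ Mn] := MP n; apply: le_trans (le_trans _ Mn) _; last by rewrite lee_fin ltW.
by apply: le_measure; rewrite ?inE//; move=> x; apply.
Qed.

Lemma null_countable (I : countType) (F : I -> set Omega) :
  (forall i, measurable (F i)) -> (forall i, mu (F i) = 0%E) ->
  measurable [set x | exists i, F i x] /\ mu [set x | exists i, F i x] = 0%E.
Proof.
move=> mF F0; pose G n := if unpickle n is Some i then F i else set0.
have -> : [set x | exists i, F i x] = \bigcup_n G n.
  apply/seteqP; split=> x; first by move=> [i Fi]; exists (pickle i) => //; rewrite /G pickleK.
  by move=> [n _]; rewrite /G; case: unpickle => // i Fi; exists i.
have mG n : measurable (G n) by rewrite /G; case: unpickle.
have mU : measurable (\bigcup_n G n) by exact: bigcup_measurable.
split=> //; apply: measure_negligible => //; apply: negligible_bigcup => n.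
exists (G n); split=> //; rewrite /G; case: unpickle => //=; exact: measure0.
Qed.

End OuterCover.

Lemma pushforward_measure_ex d1 d2 (T1 : measurableType d1) (T2 : measurableType d2)
    (R : realType) (m : {measure set T1 -> \bar R}) (f : T1 -> T2) :
  measurable_fun setT f ->
  exists mu : {measure set T2 -> \bar R}, forall A, mu A = m (f @^-1` A).
Proof.
by move=> mf; exists (measure_function_pushforward__canonical__measure_function_Measure m mf).
Qed.

(** * The measure with given masses on the balls *)

Section FlowMeasure.
Variables (R : realType) (K : fieldType) (a : K -> R) (q : nat) (rho : K).
Hypothesis HK : local_field_abs a q rho.
Variable r : 'I_q -> K.
Hypothesis Hr : residue_system a r.
Variable d : nat.

Local Notation Qd := (digit q d).
Local Notation T := (borelT (@vnorm R K a d)).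
Local Notation D := (Dn a d : set T).
Local Notation cyl := (@cyl R K a q rho r d).
Local Notation wcode := (wcode a rho r).

Variable nu : seq Qd -> R.
Hypothesis nu_ge0 : forall c, 0 <= nu c.
Hypothesis nuD : forall c, nu c = \sum_i nu (rcons c i).
Hypothesis nu_nil : nu [::] = 1.

Definition offset (c : seq Qd) (i : Qd) : R :=
  \sum_(j | (enum_rank j < enum_rank i)%N) nu (rcons c j).

(* The unit interval is cut into intervals of length [nu c], one for each word [c] of a given
   size, in lexicographic order; [lo_from [::] c] is the left end of the one of [c]. *)
Fixpoint lo_from (pre c : seq Qd) : R :=
  if c is i :: c' then offset pre i + lo_from (rcons pre i) c' else 0.

Definition itv_word (c : seq Qd) (x : R) := lo_from [::] c <= x < lo_from [::] c + nu c.

Lemma lo_rcons c i : lo_from [::] (rcons c i) = lo_from [::] c + offset c i.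
Proof.
have H pre : lo_from pre (rcons c i) = lo_from pre c + offset (pre ++ c) i.
  elim: c pre => [|j c IH] pre /=; first by rewrite cats0 addr0 add0r.
  by rewrite IH cat_rcons addrA.
exact: H.
Qed.

Lemma itv_word_ex c x : itv_word c x -> exists i, itv_word (rcons c i) x.
Proof.
rewrite /itv_word => /andP[lx xu].
(* [F k] is the right end of the first [k] subintervals; the one containing [x] is read off from the
   least [k] with [x < F k]. *)
pose F k := lo_from [::] c + \sum_(j | (enum_rank j < k)%N) nu (rcons c j).
have Fex : exists k, x < F k.
  exists #|{: Qd}|; rewrite /F; under eq_bigl do rewrite ltn_ord.
  by rewrite -nuD.
case: (ex_minnP Fex) => -[|k] xk kmin.
  by move: xk; rewrite /F big_pred0// addr0 ltNge lx.
have kQ : (k < #|{: Qd}|)%N.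
  by apply: kmin; rewrite /F; under eq_bigl do rewrite ltn_ord; rewrite -nuD.
exists (enum_val (Ordinal kQ)).
have oE : lo_from [::] c + offset c (enum_val (Ordinal kQ)) = F k by rewrite /offset enum_valK.
rewrite lo_rcons oE; apply/andP; split.
  by rewrite leNgt; apply/negP => /kmin; rewrite ltnn.
rewrite /F (bigD1 (enum_val (Ordinal kQ))) ?enum_valK//= in xk.
rewrite /F -addrA [X in _ + X]addrC.
rewrite (eq_bigl (fun j => (enum_rank j < k)%N)) // in xk.
move=> j; rewrite ltnS leq_eqVlt andb_orl.
have -> : (j != enum_val (Ordinal kQ)) = (enum_rank j != k :> nat).
  rewrite -(inj_eq enum_rank_inj) enum_valK; by [].
by case: ltngtP.
Qed.

Lemma offset_le c i j : (enum_rank i < enum_rank j)%N -> offset c i + nu (rcons c i) <= offset c j.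
Proof.
move=> ij; rewrite [offset c j]/offset (bigD1 i)//= addrC lerD2r /offset.
rewrite [leLHS](eq_bigl (fun k => (enum_rank k < enum_rank i)%N && (k != i))); last first.
  by move=> k; case: eqP => [->|]; rewrite ?ltnn ?andbT ?andbF.
rewrite big_mkcond [leRHS]big_mkcond; apply: ler_sum => k _.
case: (boolP ((_ < _)%N && _)) => [/andP[ki kni]|_]; last by case: ifP.
by rewrite kni (ltn_trans ki ij).
Qed.

Lemma itv_word_sub c i x : itv_word (rcons c i) x -> itv_word c x.
Proof.
rewrite /itv_word lo_rcons => /andP[lx xu]; apply/andP; split.
  by apply: le_trans lx; rewrite lerDl sumr_ge0.
apply: lt_le_trans xu _; rewrite -addrA lerD2l (nuD c) (bigD1 i)//= addrC lerD2l /offset.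
rewrite big_mkcond [leRHS]big_mkcond; apply: ler_sum => k _.
by case: eqP => [->|_] /=; [rewrite ltnn|case: ifP => _; [exact: lexx|exact: nu_ge0]].
Qed.

Lemma itv_word_disj c i j x : itv_word (rcons c i) x -> itv_word (rcons c j) x -> i = j.
Proof.
have H i' j' : itv_word (rcons c i') x -> itv_word (rcons c j') x ->
    (enum_rank i' < enum_rank j')%N -> False.
  rewrite /itv_word !lo_rcons => /andP[_ xi] /andP[jx _] /(offset_le c) ij.
  by have := lt_le_trans xi (le_trans _ jx); rewrite -addrA lerD2l ij ltxx => /(_ isT).
move=> xi xj; have [ij|ji|ij] := ltngtP (enum_rank i : nat) (enum_rank j : nat).
- by case: (H i j).
- by case: (H j i).
- exact/enum_rank_inj/ord_inj.
Qed.

Lemma itv_word_uniq c c' x : size c = size c' -> itv_word c x -> itv_word c' x -> c = c'.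
Proof.
elim/last_ind: c c' => [|c i IH] c'; first by case: c'.
case/lastP: c' => [|c' i']; rewrite ?size_rcons// => -[sc] xc xc'.
have E := IH c' sc (itv_word_sub xc) (itv_word_sub xc'); rewrite -{}E in xc' *.
by rewrite (itv_word_disj xc xc').
Qed.

Lemma flow_point x : exists2 y, Dn a d y &
  itv_word [::] x -> forall n, itv_word (wcode n y) x.
Proof.
have [x0|nx0] := pselect (itv_word [::] x); last first.
  by exists (pt rho r ([::] : seq Qd)) => //; exact: (pt_Dn HK Hr).
have [i0 _] := itv_word_ex x0.
have /choice[f fP] : forall c, exists i, itv_word c x -> itv_word (rcons c i) x.
  move=> c; have [/itv_word_ex[i xi]|nx] := pselect (itv_word c x); first by exists i.
  by exists i0.
pose W n := iter n (fun s => rcons s (f s)) [::].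
have [y Dy yW] := branch_limit HK Hr (fun n => f (W n)).
exists y => // _ n; rewrite yW.
have -> : mkseq (fun n => f (W n)) n = W n by elim: n => [//|n IH]; rewrite mkseqS IH.
by elim: n => [//|n IH] /=; exact: fP.
Qed.

(** The measure is the image of Lebesgue measure on [0, 1) under the map that sends [x] to a point
    whose words name the intervals containing [x]. The preimage of [cyl c] in [0, 1) is then the
    interval of [c], of length [nu c]. *)
Lemma flow_measure : exists mu : {measure set T -> \bar R},
  [/\ mu setT = 1%E, mu (~` D) = 0%E & forall c, mu (cyl c) = (nu c)%:E].
Proof.
have /choice[F FP] : forall x : R, exists y : 'rV[K]_d, Dn a d y /\
    (itv_word [::] x -> forall n, itv_word (wcode n y) x).
  by move=> x; have [y Dy yx] := flow_point x; exists y.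
have FD x : Dn a d (F x) by case: (FP x).
have unitE x : itv_word [::] x <-> 0 <= x < 1 by rewrite /itv_word nu_nil add0r.
(* Outside [0, 1) the value 0 is a filler in D; the restricted measure [m0] has no mass there. *)
pose F' (x : R) : T := if 0 <= x < 1 then F x else 0.
have F'D x : D (F' x).
  by rewrite /F'; case: ifP => // _; apply/(cong0_Dn a q); exact: (cong_refl HK).
have itvE c : [set x | itv_word c x] = `[lo_from [::] c, (lo_from [::] c + nu c)[%classic.
  by apply/seteqP; split=> x; rewrite /= in_itv.
have mitv c : measurable [set x : R | itv_word c x] by rewrite itvE; exact: measurable_itv.
have sub01 c x : itv_word c x -> 0 <= x < 1.
  by move=> xc; apply/unitE; elim/last_ind: c xc => // c i IH /itv_word_sub/IH.
have cylE c x : 0 <= x < 1 -> cyl c (F' x) <-> itv_word c x.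
  move=> x01; rewrite /F' x01; have [_ /(_ (iffRL (unitE x) x01)) h] := FP x.
  split=> [/(cyl_wcode HK Hr)[_ <-]|xc]; first exact: h.
  apply/(cyl_wcode HK Hr); split => //; apply: (itv_word_uniq (x := x)) => //.
  by rewrite (size_wcode HK Hr).
have mF'c c : measurable (F' @^-1` cyl c).
  have -> : F' @^-1` cyl c = [set x | itv_word c x] `|`
      (~` [set x | itv_word [::] x] `&` (if pselect (cyl c 0) then setT else set0)).
    apply/seteqP; split=> x /=.
      have [x01|nx01] := boolP (0 <= x < 1); first by move/(cylE c x x01); left.
      rewrite /F' (negbTE nx01) => c0; right; split; first by move/unitE; exact/negP.
      by case: pselect.
    move=> [xc|[nx]]; first by apply/cylE => //; exact: sub01 xc.
    case: pselect => // c0 _; rewrite /F' ifF//; apply/negP => x01; apply: nx; exact/unitE.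
  apply: measurableU; first exact: mitv.
  apply: measurableI; first exact: measurableC.
  by case: pselect => ? /=; [exact: measurableT|exact: measurable0].
have mF' : measurable_fun setT F'.
  have := @measurability _ _ (measurableTypeR R) T setT F' (open_nv (@vnorm R K a d)) erefl; apply.
  move=> _ [U oU <-]; rewrite setTI.
  (* There are countably many words, so an open set meets D in a countable union of cylinders. *)
  have -> : F' @^-1` U = \bigcup_(c in [set c : seq Qd | cyl c `<=` U]) (F' @^-1` cyl c).
    apply/seteqP; split=> x /=; last by move=> [c /= cU]; exact: cU.
    move=> /(open_cong_open HK oU)[n nU].
    exists (wcode n (F' x)) => /=; last first.
      by apply/(cyl_wcode HK Hr); split; [exact: F'D|rewrite (size_wcode HK Hr n (F'D x))].
    move=> y; rewrite /cyl/= (size_wcode HK Hr n (F'D x)).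
    move=> h; apply: nU; apply: (cong_trans HK (cong_wcode HK Hr n (F'D x))).
    exact: (cong_sym HK).
  rewrite bigcup_mkcond; apply: countable_bigcupT_measurable => [|c]; first exact: countableP.
  by case: ifP => _; [exact: mF'c|exact: measurable0].
pose m0 := mrestr (@lebesgue_measure R) (mitv [::]).
have [mu muE] := pushforward_measure_ex m0 mF'.
have muc c : mu (cyl c) = (nu c)%:E.
  rewrite muE [LHS](_ : _ = lebesgue_measure (F' @^-1` cyl c `&` [set x | itv_word [::] x]))//.
  have -> : F' @^-1` cyl c `&` [set x | itv_word [::] x] = [set x | itv_word c x].
    apply/seteqP; split=> x /=; first by move=> [h /unitE x01]; exact/(cylE c x x01).
    by move=> xc; have x01 := sub01 c x xc; split; [exact/cylE|exact/unitE].
  rewrite itvE lebesgue_measure_itv /= lte_fin ltrDl; case: ltP => [n0|n0].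
    by rewrite -EFinB addrAC subrr add0r.
  by congr EFin; apply/eqP; rewrite eq_le nu_ge0 n0.
have muCD : mu (~` D) = 0%E.
  rewrite muE (_ : F' @^-1` (~` D) = set0) ?measure0//.
  by apply/seteqP; split=> x //= h; exact/h/F'D.
exists mu; split=> //.
have mD : measurable D by exact: (measurable_D HK).
transitivity (mu (~` D) + mu D)%E.
  by rewrite -measureU ?setvU//; [exact: measurableC|rewrite setICl].
by rewrite muCD add0e -(cyl_nil a rho r) muc nu_nil.
Qed.

End FlowMeasure.

(** * Polar sets and capacity *)

Section Main.
Variables (R : realType) (K : fieldType) (a : K -> R) (q : nat) (rho : K).
Hypothesis HK : local_field_abs a q rho.
Variable lam : {measure set (borelT a) -> \bar R}.
Hypothesis Hlam : haar q rho lam.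
Variables N d : nat.
Hypothesis N_gt0 : (0 < N)%N.
Variables (dO : measure_display) (Omega : measurableType dO) (P : probability Omega R).
Variable Z : nat -> set 'rV[K]_N -> 'I_d -> Omega -> K.
Hypothesis HZmeas : forall n C i, is_coset a rho n C ->
  forall A : set (borelT a), measurable A -> measurable (Z n C i @^-1` A).
Hypothesis HZind : mutually_independent a P
  (fun j : nat * set 'rV[K]_N * 'I_d => is_coset a rho j.1.1 j.1.2)
  (fun j => Z j.1.1 j.1.2 j.2).
Hypothesis HZunif : forall n C i, is_coset a rho n C ->
  forall A : set (borelT a), measurable A ->
    P (Z n C i @^-1` A) =
    (lam (A `&` rhoD a rho n) * ((fine (lam (rhoD a rho n)))^-1)%:E)%E.

Local Notation qe n := ((q%:R : R) ^- n).
Local Notation QN := (digit q N).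
Local Notation Qd := (digit q d).
Local Notation M := (q ^ N)%N.
Local Notation T := (borelT (@vnorm R K a d)).
Local Notation D := (Dn a d : set T).

Definition good : set Omega :=
  [set w | forall n C i, is_coset a rho n C -> a (Z n C i w) <= qe n].

Variable X : 'rV[K]_N -> Omega -> 'rV[K]_d.
Hypothesis HX : forall w, good w -> forall t, Dn a N t ->
  forall e : R, 0 < e -> exists m0, forall m, (m0 <= m)%N ->
    vnorm a ((\sum_(n < m) \row_(i < d) Z n (coset a rho n t) i w) - X t w) < e.

Variable r : 'I_q -> K.
Hypothesis Hr : residue_system a r.

Local Notation pt := (pt rho r).
Local Notation cong := (cong a q).
Local Notation wcode := (wcode a rho r).
Local Notation cyl := (@cyl R K a q rho r d).
Local Notation Zv := (Zv a rho r Z).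
Local Notation psum := (psum a rho r Z).

(** Every coset is named by a word, so the bad event is a countable union of events of probability
    0. *)
Lemma good_null : measurable (~` good) /\ P (~` good) = 0%E.
Proof.
pose F (p : seq QN * 'I_d) : set Omega :=
  ~` (Z (size p.1) (ucoset a rho r p.1) p.2 @^-1` kball a q (size p.1) 0).
have mZ (p : seq QN * 'I_d) :
    measurable (Z (size p.1) (ucoset a rho r p.1) p.2 @^-1` kball a q (size p.1) 0).
  by apply: HZmeas; [exact: (ucosetP HK Hr)|exact: (measurable_kball HK)].
have -> : ~` good = [set w | exists p, F p w].
  apply/seteqP; split=> w /=; last first.
    move=> [[u i] /= nF] gw; apply: nF; rewrite /kball/= subr0.
    by apply: gw; exact: (ucosetP HK Hr).
  move=> ng; apply: contrapT => /forallNP nF; apply: ng => n C i [t Dt ->].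
  have /contrapT := nF (wcode n t, i); rewrite /kball/= (size_wcode HK Hr n Dt) subr0.
  by rewrite -{1}(size_wcode HK Hr n Dt) (coset_take HK Hr Dt (leqnn _))
    (size_wcode HK Hr n Dt) take_oversize ?(size_wcode HK Hr n Dt).
apply: null_countable => p; first exact: measurableC.
apply: (eq_trans (probability_setC P (mZ p))).
rewrite (Zball HK Hlam HZunif) //; last exact: (ucosetP HK Hr).
by rewrite (a0 HK) (qe_ge0 HK) subnn expr0 invr1 subee.
Qed.

(** On [good] every term of level at least [n] is 0 modulo rho^n, so by the ultrametric inequality
    the tail of the series is too, whatever the stage [m0] given by convergence. *)
Lemma X_psum w n t : good w -> Dn a N t -> cong n (X t w) (psum (wcode n t) w).
Proof.
move=> gw Dt; have [m0 mP] := HX gw Dt (qe_gt0 HK n).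
pose S m := \sum_(k < m) \row_(i < d) Z k (coset a rho k t) i w.
have Sn : S n = psum (wcode n t) w.
  rewrite /psum (size_wcode HK Hr n Dt); apply: eq_bigr => k _.
  rewrite /Zv (coset_take HK Hr Dt (ltnW (ltn_ord k))) size_takel//.
  by rewrite (size_wcode HK Hr n Dt) ltnW.
have Sm m : cong n (S (n + m)%N) (S n).
  elim: m => [|m IH]; first by rewrite addn0; exact: (cong_refl HK).
  rewrite addnS [S _.+1]big_ord_recr /= -[S n]addr0; apply: (congD HK); first exact: IH.
  move=> i; rewrite !mxE subr0; apply: le_trans (gw _ _ _ _) _; first by exists t.
  by apply: (qe_le HK); exact: leq_addr.
rewrite -Sn; apply: (cong_trans HK _ (Sm m0)); apply: (vnorm_cong HK).
exact/mP/leq_addl.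
Qed.

Lemma hit_psum w n (S : set 'rV[K]_d) : good w -> level_set (@cong d) n S ->
  (exists t, Dn a N t /\ S (X t w)) <-> exists v, size v = n /\ S (psum v w).
Proof.
move=> gw lS; split=> [[t [Dt St]]|[v [vn Sv]]].
  exists (wcode n t); split; first exact: (size_wcode HK Hr).
  exact: lS (X_psum n gw Dt) St.
have Dv : Dn a N (pt v) by exact: (pt_Dn HK Hr).
exists (pt v); split=> //; apply: lS Sv.
have := X_psum n gw Dv; rewrite (wcode_uniq HK Hr vn (cong_refl HK _ _)); exact: (cong_sym HK).
Qed.

Definition miss n (S : set 'rV[K]_d) : set Omega :=
  [set w | (forall v, (size v < n)%N -> Dn a d (Zv v w)) /\
           forall v, size v = n -> ~ S (psum v w)].

Definition leaf (S : set 'rV[K]_d) (c : seq Qd) : bool := `[< S (pt c) >].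

(** For n > 0, the probability of a hit: an average over the sub-ball picked by the single coset of
    level 0. [hitp] at the root would be the probability for M independent copies, see
    [hitp_root]. *)
Definition hprob n S : R := avg (fun i : Qd => hitp R M (leaf S) n.-1 [:: i]).

Lemma prob_missE n S : level_set (@cong d) n S -> (0 < n)%N ->
  measurable (miss n S) /\ P (miss n S) = (1 - hprob n S)%:E.
Proof.
move=> lS n0; have := prob_miss HK Hlam Hr HZmeas HZind HZunif lS n0.
by rewrite card_digit.
Qed.

Lemma hitp_root n S : (0 < n)%N -> hitp R M (leaf S) n [::] = survive M (hprob n S).
Proof. by case: n. Qed.

Lemma good_miss w n S : good w -> level_set (@cong d) n S ->
  miss n S w <-> ~ exists t, Dn a N t /\ S (X t w).
Proof.
move=> gw lS; split=> [[_ nS] /(hit_psum gw lS)[v [vn /(nS v vn)]]//|nh].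
split=> [v vn i|v vn Sv]; last by apply/nh/(hit_psum gw lS); exists v.
rewrite mxE; apply: le_trans (gw _ _ _ (ucosetP HK Hr v)) _.
by have := qe_le HK (leq0n (size v)); rewrite expr0 invr1.
Qed.

Let Qd_gt0 : (0 < #|{: Qd}|)%N.
Proof. by rewrite card_digit expn_gt0 (ltnW (q_gt1 HK)). Qed.

Let M_gt1 : (1 < M)%N.
Proof. by rewrite -(expn0 q) ltn_exp2l// (q_gt1 HK). Qed.

Let M_gt0 : 0 < M%:R :> R.
Proof. by rewrite ltr0n ltnW. Qed.

Lemma hprob01 n S : 0 <= hprob n S <= 1.
Proof. exact: (avg_hitp01 R M Qd_gt0 (leaf S) n.-1 [::]). Qed.

Variable B : set 'rV[K]_d.
Hypothesis mB : measurable (B : set T).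

Let sB : souslin (@cong d) B.
Proof.
apply: (@souslin_sigma_algebra _ (@cong d) _ _ _ _ (open_nv (@vnorm R K a d))) mB.
- exact: (cong_sym HK).
- exact: (cong_trans HK).
- exact: (cong_le HK).
- exact: (cong_refl HK).
- exact: (open_cong_open HK).
Qed.

Let capacitable (Q : set 'rV[K]_d -> Prop) :
  (forall A A', A `<=` A' -> Q A' -> Q A) ->
  (forall A : nat -> set 'rV[K]_d, (forall n, A n `<=` A n.+1) -> (forall n, Q (A n)) ->
     Q (\bigcup_n A n)) -> ~ Q B ->
  exists C : nat -> set 'rV[K]_d, [/\ forall n, level_set (@cong d) n (C n),
    forall n, C n.+1 `<=` C n, \bigcap_n C n `<=` B & forall n, ~ Q (C n)].
Proof.
move=> Q1 Q2; apply: souslin_capacitable => //.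
- exact: (cong_le HK).
- exact: (cong_refl HK).
Qed.

Lemma level_pt_rcons n C c i : level_set (@cong d) n C -> size c = n ->
  C (pt (rcons c i)) -> C (pt c).
Proof.
move=> lC sc; apply: lC; rewrite -sc.
have tk : take (size c) (rcons c i) = c by rewrite -cats1 take_size_cat.
by have := pt_take HK Hr (n := size c) (c := rcons c i); rewrite size_rcons leqnSn tk; exact.
Qed.

Definition hits : set 'rV[K]_d -> set Omega := fun S => [set w | exists t, Dn a N t /\ S (X t w)].

Lemma nonpolar_capacity : ~ P.-negligible (hits B) ->
  exists mu : {measure set T -> \bar R},
    [/\ (mu setT < +oo)%E, mu setT <> 0%E, mu (~` D) = 0%E, mu (D `\` B) = 0%E &
        (\int[mu]_x \int[mu]_y
            ufun q N d (vnorm a ((x : 'rV[K]_d) - (y : 'rV[K]_d))) < +oo)%E].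
Proof.
move=> /not_negligible_covered[c c0 nQ].
have [||//|C [lC Cdec CB nC]] := @capacitable (fun A => covered P c (hits A)).
- move=> A A' AA' [F [mF AF Fc]]; exists F; split=> //.
  by move=> w [t [Dt At]]; apply: AF; exists t; split=> //; exact: AA'.
- move=> A Ainc QA; suff -> : hits (\bigcup_n A n) = \bigcup_n hits (A n).
    by apply: covered_bigcup => // n w [t [Dt At]]; exists t; split=> //; exact: Ainc.
  apply/seteqP; split=> w; first by move=> [t [Dt [n _ At]]]; exists n => //; exists t.
  by move=> [n _ [t [Dt At]]]; exists t; split=> //; exists n.
(* Otherwise the complement of [miss n (C n)], together with a null set, would cover the hitting
   event of [C n] with probability at most [c]. *)
have hc n : (0 < n)%N -> c <= hprob n (C n).
  move=> n0; rewrite leNgt; apply/negP => hc; apply: (nC n).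
  have [mE PE] := prob_missE (lC n) n0; have [mG PG] := good_null.
  exists (~` miss n (C n) `|` ~` good); split.
  - by apply: measurableU => //; exact: measurableC.
  - move=> w hw; have [gw|] := pselect (good w); last by right.
    by left; move/(good_miss gw (lC n)).
  - have mE' : measurable (~` miss n (C n)) by exact: measurableC.
    have PCE : P (~` miss n (C n)) = (hprob n (C n))%:E.
      by rewrite probability_setC// PE -EFinB opprB addrCA subrr addr0.
    apply: le_trans (measureU2 P mE' mG) _.
    by rewrite [X in (_ + X)%E]PG adde0 [leLHS]PCE lee_fin ltW.
pose L n := leaf (C n).
have Lmono n s i : size s = n -> L n.+1 (rcons s i) -> L n s.
  move=> sn /asboolP Cs; apply/asboolP; apply: (level_pt_rcons (lC n) sn (i := i)).
  exact: Cdec.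
pose h := hlim R M L.
have h01 s : 0 <= h s <= 1 by exact: hlim01.
have hrec s : h s = survive M (avg (fun i => h (rcons s i))) by exact: hlim_rec.
have hL n : (0 < n)%N -> c <= hitp R M (L n) n [::].
  move=> n0; rewrite hitp_root//; apply: le_trans (hc n n0) _.
  by apply: survive_ge => //; exact: hprob01.
have h_root : 0 < h [::].
  apply: lt_le_trans c0 _; apply: hlim_ge => // -[|n]; last exact: hL.
  apply: le_trans (hL 1%N isT) _.
  by have := hitp_decr R Qd_gt0 M_gt1 Lmono [::] (leq0n 1); rewrite !addn0.
have fD := flow_additive hrec h_root.
have f0 := flow_ge0 h01.
have [mu [muT muCD muc]] := flow_measure HK Hr f0 fD (flow_nil h).
have muTfin : (mu setT < +oo)%E by rewrite muT ltry.
have massE' : mass rho r mu = flow h.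
  by apply/funext => s; rewrite /mass muc.
exists mu; split=> //.
- by rewrite muT; exact/eqP/oner_neq0.
(* A point of D outside [B] misses some [C n]. It lies in a cylinder of level [n] that is no leaf,
   where [hlim] and hence the flow vanish, and there are countably many such cylinders. *)
- pose F (s : seq Qd) : set T := if L (size s) s then set0 else cyl s.
  have [||mF F0] := @null_countable _ _ _ mu _ F.
  + by move=> s; rewrite /F; case: ifP => _; [exact: measurable0|exact: (measurable_cyl HK)].
  + move=> s; rewrite /F; case: (boolP (L (size s) s)) => [_|nL]; first exact: measure0.
    by rewrite muc flow_h0// /h hlim_leaf.
  apply: (@subset_measure0 _ _ _ mu _ [set x | exists s, F s x]) => //.
    by apply: measurableD => //; exact: (measurable_D HK).
  move=> x [Dx nBx]; have [n nC'] : exists n, ~ C n x.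
    by apply: contrapT => /forallNP h'; apply: nBx; apply: CB => n _; apply: contrapT; exact: h'.
  have sx := size_wcode HK Hr n Dx.
  exists (wcode n x); rewrite /F sx ifF; last first.
    apply/asboolP => Cx; apply: nC'; apply: (lC n _ _ _ Cx).
    by apply: (cong_sym HK); exact: (cong_wcode HK Hr).
  by apply/(cyl_wcode HK Hr); rewrite sx.
- rewrite (integral_energy HK Hr N_gt0 muTfin muCD) massE'.
  set b := brate _ _ _; have b0 : 0 < b := b_gt0 HK N d.
  have u0 := ucst_gt0 HK d N_gt0.
  (* The energy integral weights level k + 1 by b^k, while [energy] weights it by b^(k+1): hence the
     division by [b]. The root term of [energy] is discarded. *)
  pose bound := ucst R q N d / b * (flow h [::] ^+ 2 / h [::] / kappa R M).
  have k0 : 0 < kappa R M := kappa_gt0 R M_gt1.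
  apply: (@le_lt_trans _ _ bound%:E); last exact: ltry.
  apply: lime_le.
    apply: is_cvg_nneseries => k _ _; rewrite lee_fin mulr_ge0 ?levelsq_ge0//.
    by rewrite mulr_ge0 ?exprn_ge0 ?(ltW u0) ?(ltW b0).
  apply: nearW => n; rewrite sumEFin lee_fin big_mkord.
  have -> : \sum_(k < n) ucst R q N d * b ^+ k * levelsq (flow h) k.+1 [::] =
      ucst R q N d / b * \sum_(k < n) b ^+ k.+1 * levelsq (flow h) k.+1 [::].
    rewrite mulr_sumr; apply: eq_bigr => k _; rewrite exprS; field; exact: lt0r_neq0.
  apply: ler_wpM2l; first by apply: divr_ge0; exact: ltW.
  apply: (@le_trans _ _ (energy M (flow h) n.+1 [::])).
    rewrite /energy big_ord_recl expr0 mul1r -[leLHS]add0r.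
    by apply: lerD; [exact: sqr_ge0|exact: lexx].
  rewrite ler_pdivlMr// mulrC; exact: flow_energy.
Qed.

Lemma capacity_hprob (mu : {measure set T -> \bar R}) (C : nat -> set 'rV[K]_d) (c : R) :
  (mu setT < +oo)%E -> mu (~` D) = 0%E ->
  (\int[mu]_x \int[mu]_y
      ufun q N d (vnorm a ((x : 'rV[K]_d) - (y : 'rV[K]_d))) < +oo)%E ->
  0 < c -> (forall n, level_set (@cong d) n (C n)) ->
  (forall n, (c%:E <= mu (C n : set T))%E) ->
  exists2 e : R, 0 < e & forall n, (0 < n)%N -> e <= hprob n (C n).
Proof.
move=> muT muCD; rewrite (integral_energy HK Hr N_gt0 muT muCD).
set b := brate _ _ _; have b0 : 0 < b := b_gt0 HK N d.
have u0 := ucst_gt0 HK d N_gt0.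
set m := mass rho r mu.
pose f k := (ucst R q N d * b ^+ k * levelsq m k.+1 [::])%:E.
rewrite -/(f _) => I_fin c0 lC cC.
have f0 k : (0 <= f k)%E.
  by rewrite lee_fin mulr_ge0 ?levelsq_ge0// mulr_ge0 ?exprn_ge0 ?(ltW u0) ?(ltW b0).
set I := (\sum_(0 <= k <oo) f k)%E in I_fin.
have Ifin : I \is a fin_num by rewrite ge0_fin_numE// nneseries_ge0.
(* The same shift of levels as for the flow, with the root term added back: [E0] bounds the
   truncated energies of [mu] at every depth. *)
pose E0 := m [::] ^+ 2 + b / ucst R q N d * fine I.
have mC n : measurable (C n : set T) by exact: (measurable_level HK (lC n)).
have m_fin A : measurable A -> mu A \is a fin_num by exact: mu_fin_num.
have enE n : energy M m n.+1 [::] <= E0.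
  rewrite /energy big_ord_recl expr0 mul1r lerD2l.
  have -> : \sum_(k < n) b ^+ (bump 0 k) * levelsq m (bump 0 k) [::] =
      b / ucst R q N d * \sum_(k < n) ucst R q N d * b ^+ k * levelsq m k.+1 [::].
    rewrite mulr_sumr; apply: eq_bigr => k _; rewrite /bump add1n exprS; field.
    exact: lt0r_neq0.
  apply: ler_wpM2l; first by apply: divr_ge0; exact: ltW.
  rewrite -lee_fin fineK//.
  have : (\sum_(0 <= k < n) f k <= I)%E by apply: nneseries_lim_ge => k _ _; exact: f0.
  by rewrite {1}/f sumEFin big_mkord.
(* Restricting [mu] to [C n] gives mass 0 to the balls off [C n], as [hitp_energy] requires; by
   comparison with [mu] the energy stays below [E0]. *)
pose nu n (s : seq Qd) := fine (mu (cyl s `&` C n)).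
have nu_meas n s : measurable (cyl s `&` C n) by apply: measurableI => //; exact: (measurable_cyl HK).
have nuE n s : mu (cyl s `&` C n) = (nu n s)%:E by rewrite fineK// m_fin.
have nuD n s : nu n s = \sum_i nu n (rcons s i).
  have [||x|_] := @measure_finU _ _ _ mu _ xpredT (fun i => cyl (rcons s i) `&` C n) (cyl s `&` C n).
  - by move=> i _.
  - by move=> i j x _ _ [xi _] [xj _]; exact: (cyl_rcons_disj HK Hr xi xj).
  - split=> [[/(cyl_rcons HK Hr)[i _ xi] Cx]|[i _ [xi Cx]]]; first by exists i.
    by split=> //; apply/(cyl_rcons HK Hr); exists i.
  rewrite nuE => h; apply: EFin_inj; rewrite h -sumEFin; apply: eq_bigr => i _.
  by rewrite nuE.
have nu0 n s : 0 <= nu n s by exact: fine_ge0.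
have nu_m n s : 0 <= nu n s <= m s.
  rewrite nu0 /= -lee_fin -nuE -(massE HK r muT).
  by apply: le_measure; rewrite ?inE//; exact: (measurable_cyl HK).
have nu_root n : c <= nu n [::].
  rewrite -lee_fin -nuE; apply: le_trans (cC n) _; rewrite (cyl_nil a rho r).
  have mD : measurable D by exact: (measurable_D HK).
  have mCD : measurable (~` D) by exact: measurableC.
  have mDC : measurable (D `&` C n) by exact: measurableI.
  apply: (@le_trans _ _ (mu ((D `&` C n) `|` ~` D))).
    apply: le_measure; rewrite ?inE//; first exact: measurableU.
    by move=> x Cx; have [Dx|] := pselect (D x); [left|right].
  by apply: le_trans (measureU2 mu mDC mCD) _; rewrite [X in (_ + X)%E]muCD adde0.
have E0pos : 0 < E0.
  apply: lt_le_trans (_ : c ^+ 2 <= _); first by rewrite exprn_gt0.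
  apply: le_trans (_ : m [::] ^+ 2 <= _).
    have /andP[_ le] := nu_m 0%N [::].
    by rewrite ler_sqr ?nnegrE ?(ltW c0)//; [exact: le_trans (nu_root 0%N) le|exact: le_trans le].
  rewrite lerDl; apply: mulr_ge0; first by apply: divr_ge0; exact: ltW.
  by rewrite fine_ge0// nneseries_ge0.
(* From c^2 <= nu(root)^2 <= survive(p) E0 and survive(p) <= M p, where p is [hprob n (C n)]. *)
exists (c ^+ 2 / (M%:R * E0)); first by rewrite divr_gt0 ?exprn_gt0// mulr_gt0.
move=> n n0; rewrite ler_pdivrMr ?mulr_gt0//.
have LL s : size s = (size ([::] : seq Qd) + n)%N -> ~~ leaf (C n) s -> nu n s = 0.
  move=> sn /asboolP nC; rewrite /nu (_ : cyl s `&` C n = set0) ?measure0//.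
  apply/seteqP; split=> x // [xs Cx]; apply: nC; apply: (lC n _ _ _ Cx).
  by move: sn; rewrite add0n => <-.
have le1 := hitp_energy Qd_gt0 M_gt1 (nu0 n) (nuD n) LL.
have /andP[p0 p1] := hprob01 n (C n).
have s0 : 0 <= survive M (hprob n (C n)) by apply: survive_ge0; rewrite p0.
have up : survive M (hprob n (C n)) <= M%:R * hprob n (C n).
  apply: le_trans (survive_upper M_gt1 _); last by rewrite p0.
  rewrite ler_peMr// lerDl mulr_ge0// divr_ge0// subr_ge0 ler1n; exact: ltnW.
rewrite hitp_root// in le1.
apply: le_trans (_ : nu n [::] ^+ 2 <= _).
  by rewrite ler_sqr ?nnegrE ?(ltW c0).
apply: le_trans le1 _.
have en0 : 0 <= energy M (nu n) n.+1 [::] by exact: energy_ge0.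
have le2 : energy M (nu n) n.+1 [::] <= E0.
  by apply: le_trans (energy_le Qd_gt0 M_gt1 _ _ (nu_m n)) (enE n).
apply: le_trans (ler_pM s0 en0 up le2) _.
by rewrite [leRHS]mulrCA [leRHS]mulrA.
Qed.

(** Compactness of D^N: the words of the cosets in which X meets the set of their level form a
    finitely branching tree of unbounded depth. At the time given by an infinite branch, X agrees
    modulo rho^n with a value in [C n], for every [n]. *)
Lemma hits_capture (C : nat -> set 'rV[K]_d) w : good w ->
  (forall n, level_set (@cong d) n (C n)) -> (forall n, C n.+1 `<=` C n) ->
  (forall n, hits (C n) w) -> hits (\bigcap_n C n) w.
Proof.
move=> gw lC Cdec hw.
have [||n|g gP] := @konig _ (fun v : seq QN => exists t,
    [/\ Dn a N t, wcode (size v) t = v & C (size v) (X t w)]) (fun=> enum {: QN}).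
- move=> s i [t []]; rewrite size_rcons => Dt ts Ct; exists t; split=> //.
    by rewrite -(take_wcode HK Hr Dt (leqnSn _)) ts -cats1 take_size_cat.
  exact: Cdec.
- by move=> s i _; rewrite mem_enum.
- have [t [Dt Ct]] := hw n; exists (wcode n t); first exact: (size_wcode HK Hr).
  by exists t; rewrite (size_wcode HK Hr).
have [t Dt tg] := branch_limit HK Hr g.
exists t; split=> // n _; have [s []] := gP n; rewrite size_mkseq => Ds sg Cs.
apply: (lC n _ _ _ Cs); apply: (cong_trans HK (X_psum n gw Ds)).
by rewrite sg -tg; apply: (cong_sym HK); exact: X_psum.
Qed.

(** The events of hitting the sets [C n] decrease and have probability bounded below, hence so does
    their intersection, on which X hits [B] by [hits_capture]; a null cover of [hits B] is thus
    impossible. *)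
Lemma capacity_nonpolar (mu : {measure set T -> \bar R}) :
  (mu setT < +oo)%E -> mu setT <> 0%E -> mu (~` D) = 0%E -> mu (D `\` B) = 0%E ->
  (\int[mu]_x \int[mu]_y
      ufun q N d (vnorm a ((x : 'rV[K]_d) - (y : 'rV[K]_d))) < +oo)%E ->
  ~ P.-negligible (hits B).
Proof.
move=> muT mu0 muCD muDB I_fin.
have mD : measurable D by exact: (measurable_D HK).
have Bfin : mu (B : set T) \is a fin_num by exact: mu_fin_num.
have mCD : measurable (~` D) by exact: measurableC.
have mDB : measurable (D `\` B) by exact: measurableD.
have mBD : measurable ((B : set T) `|` (D `\` B)) by exact: measurableU.
have muTB : (mu setT <= mu (B : set T))%E.
  apply: (@le_trans _ _ (mu (((B : set T) `|` (D `\` B)) `|` ~` D))).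
    apply: le_measure; rewrite ?inE//; first exact: measurableU.
    move=> x _; have [Dx|] := pselect (D x); last by right.
    by left; have [|nBx] := pselect (B x); [left|right].
  apply: le_trans (measureU2 mu mBD mCD) _; rewrite [X in (_ + X)%E]muCD adde0.
  by apply: le_trans (measureU2 mu mB mDB) _; rewrite [X in (_ + X)%E]muDB adde0.
have B0 : 0 < fine (mu (B : set T)).
  rewrite lt_def fine_ge0// andbT; apply: contra_not_neq mu0 => muB.
  apply/eqP; rewrite eq_le measure_ge0 andbT; apply: le_trans muTB _.
  by rewrite -(fineK Bfin) muB.
(* Being strictly below mu(B), [c] does not allow a cover of [B]; being positive, it bounds all the
   masses mu(C n) away from 0. *)
pose c := fine (mu (B : set T)) / 2.
have c0 : 0 < c by rewrite divr_gt0.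
have [||F|C [lC Cdec CB nC]] := @capacitable (fun A => covered mu c (A : set T)).
- by move=> A A' AA' [F [mF AF Fc]]; exists F; split=> //; exact: subset_trans AF.
- by move=> A Ainc QA; exact: covered_bigcup.
- move: F => [F [mF BF]]; rewrite leNgt => /negP; apply.
  apply: (@lt_le_trans _ _ (mu (B : set T))); last by apply: le_measure; rewrite ?inE.
  by rewrite -(fineK Bfin) lte_fin ltr_pdivrMr// ltr_pMr// ltr1n.
have mC n : measurable (C n : set T) by exact: (measurable_level HK (lC n)).
have cC n : (c%:E <= mu (C n : set T))%E.
  by rewrite leNgt; apply/negP => /ltW h; apply: (nC n); exists (C n); split.
have [e e0 eh] := capacity_hprob muT muCD I_fin c0 lC cC.
move=> [A [mA PA hA]].
have [mG PG] := good_null.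
(* On [good], hitting [C n.+1] is the complement of the measurable event [miss]. The shift to [n.+1]
   meets the positivity condition of [prob_missE]. *)
pose F n := good `\` miss n.+1 (C n.+1).
have mmiss n : measurable (miss n.+1 (C n.+1)) by case: (prob_missE (lC n.+1) (ltn0Sn n)).
have mgood : measurable good by rewrite -[good]setCK; exact: measurableC.
have mF n : measurable (F n) by exact: measurableD.
have FE n w : F n w <-> good w /\ hits (C n.+1) w.
  split=> [[gw nm]|[gw hw]]; split=> //.
    by apply: contrapT => nh; apply: nm; apply/(good_miss gw (lC n.+1)).
  by move=> /(good_miss gw (lC n.+1)).
have eF n : (e%:E <= P (F n))%E.
  have [_ Pm] := prob_missE (lC n.+1) (ltn0Sn n).
  have PCm : P (~` miss n.+1 (C n.+1)) = (hprob n.+1 (C n.+1))%:E.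
    by rewrite probability_setC// Pm -EFinB opprB addrCA subrr addr0.
  apply: (@le_trans _ _ (P (~` miss n.+1 (C n.+1)))); first by rewrite PCm lee_fin eh.
  apply: (@le_trans _ _ (P (F n `|` ~` good))).
    apply: le_measure; rewrite ?inE; [exact: measurableC|exact: measurableU|].
    by move=> w nm; have [gw|] := pselect (good w); [left|right].
  by apply: le_trans (measureU2 P (mF n) mG) _; rewrite [X in (_ + X)%E]PG adde0.
have Fdec : nonincreasing_seq F.
  apply/nonincreasing_seqP => n; apply/subsetPset => w /FE[gw [t [Dt Ct]]].
  by apply/FE; split=> //; exists t; split=> //; exact: Cdec.
have mI : measurable (\bigcap_n F n) by exact: bigcapT_measurable.
have cv : P \o F @ \oo --> P (\bigcap_n F n).
  apply: nonincreasing_cvg_mu => //.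
  by apply: le_lt_trans (probability_le1 P (mF 0%N)) (ltry _).
have : (e%:E <= P (\bigcap_n F n))%E.
  rewrite -(cvg_lim _ cv)//; apply: lime_ge; first by apply/cvg_ex; exists (P (\bigcap_n F n)).
  by apply: nearW => n; exact: eF.
have : (P (\bigcap_n F n) <= P A)%E.
  apply: le_measure; rewrite ?inE// => w Fw; apply: hA.
  have gw : good w by have /FE[] := Fw 0%N I.
  have [n|t [Dt Ct]] := hits_capture gw lC Cdec; last first.
    by exists t; split=> //; exact: CB.
  have /FE[_ [t [Dt Ct]]] := Fw n I; exists t; split=> //; exact: Cdec.
move=> h1 h2; have := le_trans h2 h1; rewrite PA lee_fin leNgt e0; done.
Qed.

End Main.

Unset Implicit Arguments.

Theorem theorem6p5
  (R : realType) (K : fieldType) (a : K -> R) (q : nat) (rho : K)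
  (HK : local_field_abs a q rho)
  (lam : {measure set (borelT a) -> \bar R}) (Hlam : haar q rho lam)
  (N d : nat) (HN : (0 < N)%N) (Hd : (0 < d)%N)
  (dO : measure_display) (Omega : measurableType dO) (P : probability Omega R)
  (Z : nat -> set 'rV[K]_N -> 'I_d -> Omega -> K)
  (HZmeas : forall n C i, is_coset a rho n C ->
     forall A : set (borelT a), measurable A -> measurable (Z n C i @^-1` A))
  (HZind : mutually_independent a P
     (fun j : nat * set 'rV[K]_N * 'I_d => is_coset a rho j.1.1 j.1.2)
     (fun j => Z j.1.1 j.1.2 j.2))
  (HZunif : forall n C i, is_coset a rho n C ->
     forall A : set (borelT a), measurable A ->
       P (Z n C i @^-1` A) =
       (lam (A `&` rhoD a rho n) * ((fine (lam (rhoD a rho n)))^-1)%:E)%E)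
  (X : 'rV[K]_N -> Omega -> 'rV[K]_d)
  (HX : forall w : Omega,
     ((forall n C i, is_coset a rho n C -> a (Z n C i w) <= (q%:R : R) ^- n) ->
        forall t, Dn a N t ->
        forall e : R, 0 < e -> exists M, forall m, (M <= m)%N ->
          vnorm a ((\sum_(n < m) \row_(i < d) Z n (coset a rho n t) i w) - X t w) < e) /\
     (~ (forall n C i, is_coset a rho n C -> a (Z n C i w) <= (q%:R : R) ^- n) ->
        forall t, X t w = 0))
  (B : set 'rV[K]_d)
  (HBmeas : measurable (B : set (borelT (@vnorm R K a d))))
  (HBD : B `<=` Dn a d) :
  ~ P.-negligible [set w | exists t, Dn a N t /\ B (X t w)] <->
  exists mu : {measure set (borelT (@vnorm R K a d)) -> \bar R},
    [/\ (mu setT < +oo)%E, mu setT <> 0%E,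
        mu (~` Dn a d) = 0%E, mu (Dn a d `\` B) = 0%E &
        (\int[mu]_x \int[mu]_y
            ufun q N d (vnorm a ((x : 'rV[K]_d) - (y : 'rV[K]_d))) < +oo)%E].
Proof.
have [r Hr] := residue_system_ex HK Hlam.
have HX1 w : good a q rho Z w -> forall t, Dn a N t -> forall e : R, 0 < e ->
    exists m0, forall m, (m0 <= m)%N ->
    vnorm a ((\sum_(n < m) \row_(i < d) Z n (coset a rho n t) i w) - X t w) < e.
  by case: (HX w).
split; first exact: (nonpolar_capacity HK Hlam HN HZmeas HZind HZunif HX1 Hr HBmeas).
move=> [mu [muT mu0 muCD muDB I_fin]].
exact: (capacity_nonpolar HK Hlam HN HZmeas HZind HZunif HX1 Hr HBmeas muT mu0 muCD muDB I_fin).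
Qed.
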